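(* Let $k$ be an algebraically closed field of arbitrary characteristic and $A = k[[x,y,z]]/(xy)$. Then the indecomposable non-free Cohen-Macaulay $A$-modules are (up to isomorphism) described by the following matrix factorizations of $xy$: (1) $M(x,y)$ and $M(y,x)$. If $R = R_1\times R_2 = k[[x,z_1]]\times k[[y,z_2]]$ denotes the normalization of $A$ (where $x\mapsto (x,0)$, $y\mapsto (0,y)$, $z\mapsto (z_1,z_2)$), then $M(x,y)\cong R_2$ and $M(y,x)\cong R_1$ as $A$-modules. (2) $M(\varphi_n,\psi_n)$ and $M(\psi_n,\varphi_n)$ for $n\ge 1$, where $$\varphi_n=\begin{pmatrix} y & z^n\\ 0 & x\end{pmatrix},\qquad \psi_n=\begin{pmatrix} x & -z^n\\ 0& y\end{pmatrix}.$$ That is, each of these modules is an indecomposable non-free Cohen-Macaulay $A$-module, and every indecomposable non-free Cohen-Macaulay $A$-module is isomorphic to one of them.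
   Context: A finitely generated module $M$ over a Noetherian local ring $A$ is called Cohen-Macaulay (short for maximal Cohen-Macaulay) if $\mathrm{depth}(M)$ equals the Krull dimension of $A$. For $S=k[[x,y,z]]$, $f\in S$ and $A=S/(f)$, a matrix factorization of $f$ is a pair $(\alpha,\beta)$ of $n\times n$ matrices over $S$ with $\alpha\beta=\beta\alpha=f\cdot I_n$. The corresponding $A$-module is $M(\alpha,\beta)=\mathrm{coker}(\alpha: S^n\to S^n)$ (which is annihilated by $f$), equivalently the cokernel of $\bar\alpha: A^n\to A^n$. *)

(* Defs.v *)
From HB Require Import structures.
From mathcomp Require Import all_boot all_order all_algebra.
From mathcomp Require Import generic_quotient ring_quotient boolp.

Set Implicit Arguments.
Unset Strict Implicit.
Unset Printing Implicit Defensive.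

Import GRing.Theory.
Local Open Scope ring_scope.
Local Open Scope quotient_scope.

(* [Fps f] stands for \sum_i f i X^i; [f i] is the coefficient of X^i. *)
Record fps (R : Type) : Type := Fps { coefs :> nat -> R }.

HB.instance Definition _ (R : Type) := gen_eqMixin (fps R).
HB.instance Definition _ (R : Type) := gen_choiceMixin (fps R).

Lemma fpsP (R : Type) (f g : fps R) : (forall i, f i = g i) -> f = g.
Proof. by case: f g => [f] [g] /= /funext ->. Qed.

Section FpsZmod.
Variable R : zmodType.
Implicit Types f g : fps R.

Definition fps_zero : fps R := Fps (fun=> 0).
Definition fps_opp f : fps R := Fps (fun i => - f i).
Definition fps_add f g : fps R := Fps (fun i => f i + g i).

Lemma fps_addA : associative fps_add.
Proof. by move=> f g h; apply: fpsP => i /=; rewrite addrA. Qed.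
Lemma fps_addC : commutative fps_add.
Proof. by move=> f g; apply: fpsP => i /=; rewrite addrC. Qed.
Lemma fps_add0 : left_id fps_zero fps_add.
Proof. by move=> f; apply: fpsP => i /=; rewrite add0r. Qed.
Lemma fps_addN : left_inverse fps_zero fps_opp fps_add.
Proof. by move=> f; apply: fpsP => i /=; rewrite addNr. Qed.

HB.instance Definition _ :=
  GRing.isZmodule.Build (fps R) fps_addA fps_addC fps_add0 fps_addN.
End FpsZmod.

(* Locked so that conversion does not unfold nested products. *)
HB.lock Definition fps_mul (R : comNzRingType) (f g : fps R) : fps R :=
  Fps (fun n => \sum_(i < n.+1) f i * g (n - i)%N).

Lemma fps_mulE (R : comNzRingType) (f g : fps R) n :
  fps_mul f g n = \sum_(i < n.+1) f i * g (n - i)%N.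
Proof. by rewrite fps_mul.unlock. Qed.

Section FpsRing.
Variable R : comNzRingType.
Implicit Types f g h : fps R.

Definition fpsC (a : R) : fps R := Fps (fun i => if i == 0%N then a else 0).
Definition fpsX : fps R := Fps (fun i => (i == 1%N)%:R).

(* Truncations: the ring axioms are inherited from {poly R}. *)
Definition fps_trunc (n : nat) f : {poly R} := \poly_(i < n.+1) f i.

Lemma fps_mul_trunc f g (m n i : nat) : (i <= m)%N -> (i <= n)%N ->
  fps_mul f g i = (fps_trunc m f * fps_trunc n g)`_i.
Proof.
move=> im jn; rewrite fps_mulE coefM /=; apply: eq_bigr => j _.
rewrite !coef_poly !ltnS (leq_trans _ im) ?(leq_trans (leq_subr _ _) jn) //.
by rewrite -ltnS ltn_ord.
Qed.

Lemma fps_mulC : commutative (@fps_mul R).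
Proof.
by move=> f g; apply: fpsP => i; rewrite !(@fps_mul_trunc _ _ i i) // mulrC.
Qed.

Lemma fps_mulA : associative (@fps_mul R).
Proof.
move=> f g h; apply: fpsP => n.
transitivity ((fps_trunc n f * (fps_trunc n g * fps_trunc n h))`_n).
  rewrite fps_mulE coefM /=; apply: eq_bigr => i _.
  rewrite coef_poly ltn_ord; congr (_ * _).
  by rewrite -(@fps_mul_trunc _ _ n n) // leq_subr.
rewrite fps_mulE mulrA coefM /=; apply: eq_bigr => i _.
rewrite coef_poly ltnS leq_subr; congr (_ * _).
by rewrite -(@fps_mul_trunc _ _ n n) // -ltnS.
Qed.

Lemma fps_mul1 : left_id (fpsC 1) (@fps_mul R).
Proof.
move=> f; apply: fpsP => n; rewrite fps_mulE /=.
by rewrite big_ord_recl /= subn0 mul1r big1 ?addr0 // => i _; rewrite mul0r.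
Qed.

Lemma fps_mulDl : left_distributive (@fps_mul R) +%R.
Proof.
move=> f g h; apply: fpsP => n; rewrite /= !fps_mulE -big_split /=.
by apply: eq_bigr => i _; rewrite mulrDl.
Qed.

Lemma fps_one_neq0 : fpsC 1 != 0.
Proof. by apply/eqP => /(congr1 (fun f : fps R => f 0%N)) /eqP; rewrite oner_eq0. Qed.

HB.instance Definition _ := GRing.Zmodule_isComNzRing.Build (fps R)
  fps_mulA fps_mulC fps_mul1 fps_mulDl fps_one_neq0.

Definition fps_coef0 f : R := f 0%N.

Lemma fps_coef0_zmod : zmod_morphism fps_coef0.
Proof. by []. Qed.
Lemma fps_coef0_monoid : monoid_morphism fps_coef0.
Proof. by split=> // f g; rewrite /fps_coef0 fps_mulE big_ord1. Qed.

HB.instance Definition _ :=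
  GRing.isZmodMorphism.Build (fps R) R fps_coef0 fps_coef0_zmod.
HB.instance Definition _ :=
  GRing.isMonoidMorphism.Build (fps R) R fps_coef0 fps_coef0_monoid.
End FpsRing.
Arguments fpsX {R}.

Section FpsMap.
Variables (R T : comNzRingType) (u : {rmorphism R -> T}).

Definition fps_map (f : fps R) : fps T := Fps (fun i => u (f i)).

Lemma fps_map_zmod : zmod_morphism fps_map.
Proof. by move=> f g; apply: fpsP => i /=; rewrite rmorphB. Qed.
Lemma fps_map_monoid : monoid_morphism fps_map.
Proof.
split=> [|f g]; apply: fpsP => i /=.
  by case: eqP => _; rewrite ?rmorph1 ?rmorph0.
by rewrite !fps_mulE rmorph_sum; apply: eq_bigr => j _; rewrite rmorphM.
Qed.

HB.instance Definition _ :=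
  GRing.isZmodMorphism.Build (fps R) (fps T) fps_map fps_map_zmod.
HB.instance Definition _ :=
  GRing.isMonoidMorphism.Build (fps R) (fps T) fps_map fps_map_monoid.
End FpsMap.

Section QuotientModule.
Variables (A : comNzRingType) (V : lmodType A) (N : submodClosed V).

(* Over a ring, scaling by -1 makes a submodule closed under subtraction. *)
Definition submod_pred : {pred V} := N.

Lemma submod_pred_zmod : zmod_closed submod_pred.
Proof.
rewrite /submod_pred; split=> [|v w Nv Nw]; first exact: rpred0.
by rewrite -scaleN1r; apply: rpredD => //; apply: rpredZ.
Qed.
HB.instance Definition _ :=
  GRing.isZmodClosed.Build V submod_pred submod_pred_zmod.

Definition quotmod := {ideal_quot submod_pred}.
HB.instance Definition _ := GRing.Zmodule.on quotmod.
HB.instance Definition _ := EqQuotient.on quotmod.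

Definition quotmod_scale (a : A) (m : quotmod) : quotmod :=
  \pi_quotmod (a *: repr m).

Lemma quotmod_eq (v w : V) : (\pi_quotmod v == \pi_quotmod w) = (v - w \in N).
Proof. exact: esym (@Quotient.idealrBE V submod_pred _ _). Qed.

Lemma quotmod_piD (v w : V) :
  \pi_quotmod (v + w) = \pi_quotmod v + \pi_quotmod w.
Proof. by rewrite -[LHS]/(\pi_{ideal_quot submod_pred} (v + w)) raddfD. Qed.

Lemma quotmod_piZ (a : A) (v : V) :
  \pi_quotmod (a *: v) = quotmod_scale a (\pi_quotmod v).
Proof.
apply/eqP; rewrite /quotmod_scale quotmod_eq -scalerBr rpredZ //.
by rewrite -quotmod_eq reprK.
Qed.

Lemma quotmod_piP (m : quotmod) : exists v, m = \pi_quotmod v.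
Proof. by exists (repr m); rewrite reprK. Qed.

Lemma quotmod_scaleA (a b : A) (m : quotmod) :
  quotmod_scale a (quotmod_scale b m) = quotmod_scale (a * b) m.
Proof.
by have [v ->] := quotmod_piP m; rewrite -!quotmod_piZ scalerA.
Qed.
Lemma quotmod_scale1 : left_id 1 quotmod_scale.
Proof.
by move=> m; have [v ->] := quotmod_piP m; rewrite -quotmod_piZ scale1r.
Qed.
Lemma quotmod_scaleDr : right_distributive quotmod_scale +%R.
Proof.
move=> a m p; have [v ->] := quotmod_piP m; have [w ->] := quotmod_piP p.
by rewrite -quotmod_piD -!quotmod_piZ scalerDr quotmod_piD.
Qed.
Lemma quotmod_scaleDl (m : quotmod) : {morph quotmod_scale^~ m : a b / a + b}.
Proof.
move=> a b; have [v ->] := quotmod_piP m.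
by rewrite -!quotmod_piZ scalerDl quotmod_piD.
Qed.

HB.instance Definition _ := GRing.Zmodule_isLmodule.Build A quotmod
  quotmod_scaleA quotmod_scale1 quotmod_scaleDr quotmod_scaleDl.
End QuotientModule.

Section Cokernel.
Variables (A : comNzRingType) (m n : nat) (B : 'M[A]_(m, n)).

Definition colspan : {pred 'cV[A]_m} :=
  fun v => `[< exists w : 'cV[A]_n, v = B *m w >].

Lemma colspan_submod : submod_closed colspan.
Proof.
split=> [|a v w /asboolP [v' ->] /asboolP [w' ->]]; apply/asboolP.
  by exists 0; rewrite mulmx0.
by exists (a *: v' + w'); rewrite mulmxDr scalemxAr.
Qed.
HB.instance Definition _ :=
  GRing.isSubmodClosed.Build A 'cV[A]_m colspan colspan_submod.

Definition coker : lmodType A := quotmod colspan.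
End Cokernel.

(* B as an A-module via u; the argument u selects the scaling. *)
Definition restrict_scalars (A B : comNzRingType) (u : {rmorphism A -> B}) :
  Type := B.

Section RestrictScalars.
Variables (A B : comNzRingType) (u : {rmorphism A -> B}).
Local Notation Bu := (restrict_scalars u).

HB.instance Definition _ := GRing.Zmodule.copy Bu B.

Definition rs_scale (a : A) (b : Bu) : Bu :=
  (u a * b : B).

Lemma rs_scaleA (a b : A) (c : Bu) :
  rs_scale a (rs_scale b c) = rs_scale (a * b) c.
Proof. by rewrite /rs_scale rmorphM mulrA. Qed.
Lemma rs_scale1 : left_id 1 rs_scale.
Proof. by move=> c; rewrite /rs_scale rmorph1 mul1r. Qed.
Lemma rs_scaleDr : right_distributive rs_scale +%R.
Proof. by move=> a c d; rewrite /rs_scale mulrDr. Qed.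
Lemma rs_scaleDl (c : Bu) : {morph rs_scale^~ c : a b / a + b}.
Proof. by move=> a b; rewrite /rs_scale rmorphD mulrDl. Qed.

HB.instance Definition _ := GRing.Zmodule_isLmodule.Build A Bu
  rs_scaleA rs_scale1 rs_scaleDr rs_scaleDl.
End RestrictScalars.

Section Ideals.
Variable A : comNzRingType.

(* When A is local, these are the elements of the maximal ideal. *)
Definition nonunit (a : A) : Prop := ~ exists b, a * b = 1.

Definition principal_ideal (f : A) : {pred A} :=
  fun g => `[< exists h : A, g = h * f >].

Lemma principal_ideal_closed (f : A) :
  nonunit f -> idealr_closed (principal_ideal f).
Proof.
move=> nf; split=> [||a u v /asboolP [u' ->] /asboolP [v' ->]].
- by apply/asboolP; exists 0; rewrite mul0r.
- by apply/asboolP => -[h e]; apply: nf; exists h; rewrite mulrC -e.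
- by apply/asboolP; exists (a * u' + v'); rewrite mulrDl mulrA.
Qed.
End Ideals.

Section Modules.
Variable A : comNzRingType.
Implicit Types M N : lmodType A.

Definition mod_iso M N : Prop := exists f : {linear M -> N}, bijective f.

Definition mod_zero M : Prop := forall m : M, m = 0.

Definition finitely_generated M : Prop :=
  exists (n : nat) (e : 'I_n -> M),
    forall m, exists c : 'I_n -> A, m = \sum_(i < n) c i *: e i.

(* Free of finite rank; for a finitely generated module this is freeness. *)
Definition mod_free M : Prop := exists n : nat, mod_iso M 'cV[A]_n.

Definition indecomposable M : Prop :=
  ~ mod_zero M /\
  forall N1 N2 : lmodType A, mod_iso M (N1 * N2)%type ->
    mod_zero N1 \/ mod_zero N2.

(* m belongs to the submodule (s_0, ..., s_(r-1)) M *)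
Definition in_seq_mul M (s : seq A) (m : M) : Prop :=
  exists c : nat -> M, m = \sum_(i < size s) s`_i *: c i.

(* s_i is a nonzerodivisor on M / (s_0, ..., s_(i-1)) M for every i, and
   M <> (s) M. *)
Definition regular_sequence M (s : seq A) : Prop :=
  (forall i, (i < size s)%N -> forall m : M,
     in_seq_mul (take i s) (s`_i *: m) -> in_seq_mul (take i s) m)
  /\ exists m : M, ~ in_seq_mul s m.

Definition regular_sequence_in_max M (s : seq A) : Prop :=
  (forall a, a \in s -> nonunit a) /\ regular_sequence M s.

Definition has_depth M (d : nat) : Prop :=
  (exists2 s, regular_sequence_in_max M s & size s = d) /\
  (forall s, regular_sequence_in_max M s -> (size s <= d)%N).

Definition prime_ideal (p : {pred A}) : Prop :=
  idealr_closed p /\ prime_idealr_closed p.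

Definition prime_chain (d : nat) (p : nat -> {pred A}) : Prop :=
  (forall i, (i <= d)%N -> prime_ideal (p i)) /\
  (forall i, (i < d)%N ->
     {subset p i <= p i.+1} /\ ~ {subset p i.+1 <= p i}).

Definition has_krull_dim (d : nat) : Prop :=
  (exists p, prime_chain d p) /\
  (forall e, (exists p, prime_chain e p) -> (e <= d)%N).

(* (Maximal) Cohen-Macaulay modules, for A Noetherian local. *)
Definition cohen_macaulay M : Prop :=
  finitely_generated M /\ exists2 d, has_krull_dim d & has_depth M d.

End Modules.

Definition is_total_fraction_ring (A Q : comNzRingType)
    (i : {rmorphism A -> Q}) : Prop :=
  [/\ injective i,
      forall s : A, GRing.lreg s -> exists u, i s * u = 1
    & forall q : Q, exists a s : A, GRing.lreg s /\ q * i s = i a].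

(* nu identifies B with the integral closure of A in its total ring of
   fractions. *)
Definition is_normalization (A B : comNzRingType)
    (nu : {rmorphism A -> B}) : Prop :=
  exists (Q : comNzRingType) (j : {rmorphism B -> Q}),
    [/\ is_total_fraction_ring (j \o nu : {rmorphism A -> Q}),
        injective j
      & forall q : Q, integralOver (j \o nu) q <-> exists b, q = j b].

Record matrix_factorization (S : comNzRingType) (f : S) (n : nat) : Type :=
  MatrixFactorization {
    mf_alpha : 'M[S]_n;
    mf_beta : 'M[S]_n;
    mf_alphaK : mf_alpha *m mf_beta = f%:M;
    mf_betaK : mf_beta *m mf_alpha = f%:M
  }.

Definition mf_swap (S : comNzRingType) (f : S) (n : nat)
    (F : matrix_factorization f n) : matrix_factorization f n :=
  MatrixFactorization (mf_betaK F) (mf_alphaK F).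

Definition mx2 (S : nzRingType) (a b c d : S) : 'M[S]_2 :=
  \matrix_(i < 2, j < 2)
    (if i == 0 then (if j == 0 then a else b)
     else (if j == 0 then c else d)).

Lemma mul_mx2 (S : nzRingType) (a b c d a' b' c' d' : S) :
  mx2 a b c d *m mx2 a' b' c' d' =
  mx2 (a * a' + b * c') (a * b' + b * d') (c * a' + d * c') (c * b' + d * d').
Proof.
apply/matrixP => i j; rewrite !mxE !big_ord_recl big_ord0 !mxE /= addr0.
by case: (i == 0); case: (j == 0).
Qed.

Lemma mx2_scalar (S : nzRingType) (a : S) : mx2 a 0 0 a = a%:M.
Proof. by apply/matrixP => -[[|[|//]] ?] [[|[|//]] ?]; rewrite !mxE. Qed.

Section Ainfty.
Variable k : fieldType.

(* k[[x,y,z]] = k[[z]][[y]][[x]]: for f : Sring, the coefficient of x^a y^b z^c is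
   f a b c. *)
Definition Sring : comNzRingType := fps (fps (fps k)).
Definition Sx : Sring := fpsX.
Definition Sy : Sring := fpsC fpsX.
Definition Sz : Sring := fpsC (fpsC fpsX).

Definition xy_ideal : {pred Sring} := principal_ideal (Sx * Sy).

Lemma xy_nonunit : nonunit (Sx * Sy).
Proof.
case=> h /(congr1 (@fps_coef0 _)); rewrite !rmorphM rmorph1 /=.
by rewrite mul0r mul0r => /esym/eqP; rewrite oner_eq0.
Qed.

HB.instance Definition _ := isIdealr.Build Sring xy_ideal (principal_ideal_closed xy_nonunit).

Definition Aring : comNzRingType := {ideal_quot xy_ideal}.
Definition toA : {rmorphism Sring -> Aring} := \pi_{ideal_quot xy_ideal}.

(* R1ring = k[[x,z]] = k[[z]][[x]] and R2ring = k[[y,z]] = k[[z]][[y]]. *)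
Definition R1ring : comNzRingType := fps (fps k).
Definition R2ring : comNzRingType := fps (fps k).

(* f(x,y,z) |-> f(x,0,z) and f(x,y,z) |-> f(0,y,z) *)
Definition S_to_R1 : {rmorphism Sring -> R1ring} := fps_map (@fps_coef0 (fps k)).
Definition S_to_R2 : {rmorphism Sring -> R2ring} := @fps_coef0 (fps (fps k)).

Definition nu_fun (a : Aring) : R1ring * R2ring := (S_to_R1 (repr a), S_to_R2 (repr a)).

Lemma nu_toA (f : Sring) : nu_fun (toA f) = (S_to_R1 f, S_to_R2 f).
Proof.
have /asboolP [h] : repr (toA f) - f \in xy_ideal.
  by rewrite Quotient.idealrBE; apply/eqP; rewrite reprK.
move/eqP; rewrite subr_eq => /eqP E.
rewrite /nu_fun E !rmorphD !rmorphM.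
have -> : S_to_R1 Sy = 0 by apply: fpsP => -[|i] /=; apply: fpsP.
have -> : S_to_R2 Sx = 0 by [].
by rewrite !mulr0 mul0r mulr0 !add0r.
Qed.

Lemma toA_surj (a : Aring) : exists f, a = toA f.
Proof. by exists (repr a); rewrite /toA /= reprK. Qed.

Lemma nu_zmod : zmod_morphism nu_fun.
Proof.
move=> a b; have [f ->] := toA_surj a; have [g ->] := toA_surj b.
by rewrite -rmorphB !nu_toA !rmorphB.
Qed.
Lemma nu_monoid : monoid_morphism nu_fun.
Proof.
split=> [|a b]; first by rewrite -(rmorph1 toA) nu_toA !rmorph1.
have [f ->] := toA_surj a; have [g ->] := toA_surj b.
by rewrite -rmorphM !nu_toA !rmorphM.
Qed.
HB.instance Definition _ :=
  GRing.isZmodMorphism.Build Aring (R1ring * R2ring)%type nu_fun nu_zmod.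
HB.instance Definition _ :=
  GRing.isMonoidMorphism.Build Aring (R1ring * R2ring)%type nu_fun nu_monoid.

Definition nu : {rmorphism Aring -> (R1ring * R2ring)%type} := nu_fun.

Lemma nu_x : nu (toA Sx) = (fpsX, 0).
Proof.
rewrite /nu /= nu_toA; congr (_, _).
by apply: fpsP => i /=; rewrite rmorph_nat.
Qed.
Lemma nu_y : nu (toA Sy) = (0, fpsX).
Proof.
rewrite /nu /= nu_toA; congr (_, _).
by apply: fpsP => -[|i] /=; apply: fpsP.
Qed.
Lemma nu_z : nu (toA Sz) = (fpsC fpsX, fpsC fpsX).
Proof.
rewrite /nu /= nu_toA; congr (_, _).
by apply: fpsP => -[|i] /=; apply: fpsP.
Qed.

Definition nu1 : {rmorphism Aring -> R1ring} := fst \o nu.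
Definition nu2 : {rmorphism Aring -> R2ring} := snd \o nu.

Definition R1mod : lmodType Aring := restrict_scalars nu1.
Definition R2mod : lmodType Aring := restrict_scalars nu2.

Definition mf_module (n : nat) (F : matrix_factorization (Sx * Sy) n) :
    lmodType Aring :=
  coker (map_mx toA (mf_alpha F)).

Lemma mf_xy_proof : (Sx%:M : 'M[Sring]_1) *m Sy%:M = (Sx * Sy)%:M.
Proof. by rewrite -scalar_mxM. Qed.
Lemma mf_yx_proof : (Sy%:M : 'M[Sring]_1) *m Sx%:M = (Sx * Sy)%:M.
Proof. by rewrite -scalar_mxM mulrC. Qed.
Definition mf_xy : matrix_factorization (Sx * Sy) 1 :=
  MatrixFactorization mf_xy_proof mf_yx_proof.

Definition phi (n : nat) : 'M[Sring]_2 := mx2 Sy (Sz ^+ n) 0 Sx.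
Definition psi (n : nat) : 'M[Sring]_2 := mx2 Sx (- Sz ^+ n) 0 Sy.

Lemma phi_psi (n : nat) : phi n *m psi n = (Sx * Sy)%:M.
Proof.
rewrite mul_mx2 !(mulr0, mul0r, addr0, add0r) [Sy * Sx]mulrC mulrN.
by rewrite [Sy * _]mulrC addNr mx2_scalar.
Qed.
Lemma psi_phi (n : nat) : psi n *m phi n = (Sx * Sy)%:M.
Proof.
rewrite mul_mx2 !(mulr0, mul0r, addr0, add0r) [Sy * Sx]mulrC mulNr.
by rewrite [Sx * Sz ^+ n]mulrC subrr mx2_scalar.
Qed.
Definition mf_phi_psi (n : nat) : matrix_factorization (Sx * Sy) 2 :=
  MatrixFactorization (phi_psi n) (psi_phi n).

End Ainfty.

(* Main.v *)
(* The idea.  Write R = k[[z]][[w]].  Killing y, resp. x, identifies A with the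
   fibre product of two copies of R over k[[z]], and the diagonal makes A a free
   R-module with basis 1, x, where w = x + y and x(x - w) = 0.

   A regular sequence of length two on M kills the Koszul homology of (w, z) on
   M, so M is free over R: it is R^r with x acting by a matrix X such that
   X^2 = wX.  Such modules are classified by splitting off one summand.  Let z^n
   be the exact power of z dividing X modulo w and write X = z^n Y + w P.  If
   X = w P, then P is idempotent and M contains a branch R_1 or R_2.  If n = 0,
   then A splits off.  If n > 0, then P is idempotent modulo z^n and
   Y = YP + PY modulo w, so PY(1 - P) or (1 - P)YP has a unit entry; that entry
   gives an A-linear retraction of M onto the ideal (x, z^n) or (y, z^n).

   Conversely the listed modules are the ideals (y), (x), (x, z^n), (y, z^n) of
   A, whose properties are read off in the two copies of R. *)
Require Import Defs.
From mathcomp Require Import all_boot all_order all_algebra.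
From HB Require Import structures.
From mathcomp Require Import generic_quotient ring_quotient boolp ring.

Set Implicit Arguments.
Unset Strict Implicit.
Unset Printing Implicit Defensive.

Import GRing.Theory.
Local Open Scope ring_scope.

(** * Power series *)

(** Nearly everything about A is proved for an abstract fibre product: exchanging its two
    projections replaces X by w - X, so a statement about one branch also serves for the other. The
    obstacle in comparing an arbitrary regular sequence with (w, z) is that x is a nonunit outside
    (w, z)A. Its square wx lies inside, and so do the squares of all nonunits; squares of regular
    elements therefore carry both the freeness over R and the bound two on depths. Idempotence of P
    modulo z^n has its origin in X^2 = wX. Choosing Y with entries in k[[z]] gives Y^2 = 0 exactly,
    and the equation becomes z^n (YP + PY - Y) = w (P - P^2), where z^n and w are coprime. Normality
    of R is obtained from complete integral closedness, because that property, unlike integral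
    closedness, passes from a domain to its power series ring. *)

Lemma course_of_values (T : Type) (x0 : T) (F : nat -> (nat -> T) -> T) :
    (forall n s t, (forall i, (i < n)%N -> s i = t i) -> F n s = F n t) ->
  exists s, forall n, s n = F n s.
Proof.
move=> Fext.
(* [G n] lists the first [n] values; [x0] only fills the positions beyond them, on which [F n] does
   not depend. *)
pose G := fix G n : seq T :=
  if n is m.+1 then rcons (G m) (F m (nth x0 (G m))) else [::].
have sG n : size (G n) = n by elim: n => //= n IH; rewrite size_rcons IH.
have GS n m i : (i < n)%N -> (n <= m)%N -> nth x0 (G m) i = nth x0 (G n) i.
  move=> lin; elim: m => [|m IH]; first by rewrite leqn0 => /eqP e; rewrite e in lin.
  rewrite leq_eqVlt => /predU1P[-> //|lenm] /=.
  by rewrite nth_rcons sG (leq_trans lin lenm) IH.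
exists (fun n => nth x0 (G n.+1) n) => n /=.
rewrite nth_rcons sG ltnn eqxx; apply: Fext => i lin.
by rewrite (GS i.+1 n).
Qed.

Section FpsBasics.
Variable R : comNzRingType.
Implicit Types (a : R) (f g h : fps R).

Lemma fpsM f g n : (f * g) n = \sum_(i < n.+1) f i * g (n - i)%N.
Proof. exact: fps_mulE. Qed.

Lemma fpsD f g n : (f + g) n = f n + g n. Proof. by []. Qed.

Lemma fps_sum (I : Type) (r : seq I) (P : pred I) (F : I -> fps R) n :
  (\sum_(i <- r | P i) F i) n = \sum_(i <- r | P i) F i n.
Proof. exact: (big_morph (fun f : fps R => f n) (fun f g => fpsD f g n)). Qed.

Lemma fpsCM a f n : (fpsC a * f) n = a * f n.
Proof.
rewrite fpsM big_ord_recl /= subn0 big1 ?addr0 // => i _.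
by rewrite mul0r.
Qed.

Lemma fpsXM f n : (fpsX * f) n = if n is m.+1 then f m else 0.
Proof.
rewrite fpsM; case: n => [|n]; first by rewrite big_ord1 mul0r.
rewrite !big_ord_recl /= mul0r add0r mul1r subSS subn0 big1 ?addr0 // => i _.
by rewrite mul0r.
Qed.

Lemma fpsXnM m f n : (fpsX ^+ m * f) n = if (n < m)%N then 0 else f (n - m)%N.
Proof.
elim: m n => [|m IH] n; first by rewrite expr0 mul1r ltn0 subn0.
by rewrite exprS -mulrA fpsXM; case: n => [|n] //; rewrite IH.
Qed.

Lemma fpsC_zmod : zmod_morphism (@fpsC R).
Proof. by move=> a b; apply: fpsP => i /=; case: eqP => //; rewrite subr0. Qed.
Lemma fpsC_monoid : monoid_morphism (@fpsC R).
Proof.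
split=> // a b; apply: fpsP => i; rewrite fpsCM /=.
by case: eqP => //; rewrite mulr0.
Qed.
HB.instance Definition _ :=
  GRing.isZmodMorphism.Build R (fps R) (@fpsC R) fpsC_zmod.
HB.instance Definition _ :=
  GRing.isMonoidMorphism.Build R (fps R) (@fpsC R) fpsC_monoid.

Lemma fps_coef0C a : fps_coef0 (fpsC a) = a. Proof. by []. Qed.

Lemma fps_coef0M f g : fps_coef0 (f * g) = fps_coef0 f * fps_coef0 g.
Proof. exact: rmorphM. Qed.

Lemma fps_coef0Xn f n : fps_coef0 (f ^+ n) = fps_coef0 f ^+ n.
Proof. exact: rmorphXn. Qed.

Lemma fps_coef0X : fps_coef0 (fpsX : fps R) = 0. Proof. by []. Qed.

Lemma fpsX_neq0 : (fpsX : fps R) != 0.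
Proof. by apply/eqP => /(congr1 (fun f : fps R => f 1%N)) /eqP; rewrite /= oner_eq0. Qed.

Lemma fpsXn_inj m : injective (fun f => fpsX ^+ m * f).
Proof.
move=> f g e; apply: fpsP => i.
have := congr1 (fun h : fps R => h (i + m)%N) e.
by rewrite !fpsXnM ltnNge leq_addl /= addnK.
Qed.

Lemma fpsX_inj : injective (fun f => fpsX * f).
Proof. exact: (@fpsXn_inj 1). Qed.

Lemma fps_coef0_eq0 f : fps_coef0 f = 0 -> exists g, f = fpsX * g.
Proof.
move=> f0; exists (Fps (fun i => f i.+1)); apply: fpsP => -[|i]; rewrite fpsXM //.
Qed.

Lemma fps_split f : exists g, f = fpsC (fps_coef0 f) + fpsX * g.
Proof.
have [|g e] := @fps_coef0_eq0 (f - fpsC (fps_coef0 f)).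
  by rewrite rmorphB; apply: subrr.
by exists g; rewrite -e addrC subrK.
Qed.

Lemma fps_order f : f != 0 -> exists m g, f = fpsX ^+ m * g /\ fps_coef0 g != 0.
Proof.
move=> nz.
have ex : exists i, f i != 0.
  apply: contrapT => /forallNP h; case/eqP: nz; apply: fpsP => i.
  by apply/eqP; apply: contrapT => /negP; apply: h.
exists (ex_minn ex), (Fps (fun i => f (i + ex_minn ex)%N)).
case: ex_minnP => m fm min; split; last by rewrite /fps_coef0 /= add0n.
apply: fpsP => i; rewrite fpsXnM; case: ltnP => [lim|lmi] /=; last by rewrite subnK.
by apply/eqP; apply: contraTT lim => /min; rewrite -leqNgt.
Qed.

(* Long division by increasing powers; the last clause says that each
   coefficient of the remainder is a remainder of [div]. *)
Lemma fps_division f (div : R -> R * R) :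
    (forall a, a = (div a).1 * fps_coef0 f + (div a).2) ->
  forall h, exists q r, h = q * f + r /\
    forall i, r i = (div (q i * fps_coef0 f + r i)).2.
Proof.
move=> divE h.
pose e (n : nat) (s : nat -> R) := h n - \sum_(i < n) s i * f (n - i)%N.
have [n s t st|q qE] := @course_of_values R 0 (fun n s => (div (e n s)).1).
  by rewrite /e; under eq_bigr => i _ do rewrite st //.
have eE n : e n q = q n * fps_coef0 f + (div (e n q)).2 by rewrite {1}[e n q]divE -qE.
exists (Fps q), (Fps (fun n => (div (e n q)).2)).
split=> [|i] /=; last by rewrite -eE.
apply: fpsP => n; rewrite fpsD fpsM big_ord_recr /= subnn -addrA -eE /e.
by rewrite addrC subrK.
Qed.

(** Long division of 1 by [f], with every remainder zero. *)
Lemma fps_inverse f a : a * fps_coef0 f = 1 -> exists g, g * f = 1.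
Proof.
move=> af; have [b|q [r [e re]]] := @fps_division f (fun b => (b * a, 0)) _ 1.
  by rewrite addr0 -mulrA af mulr1.
by exists q; rewrite e (_ : r = 0) ?addr0 //; apply: fpsP => i; rewrite re.
Qed.

(** Inverses are picked by choice, which gives a unit ring structure over any commutative ring and
    so applies to nested series; off the units the inverse is the identity, as the interface
    demands. *)
Definition fps_unit : {pred fps R} := fun f => `[< exists g, g * f = 1 >].
Definition fps_inv f : fps R :=
  if pselect (exists g, g * f = 1) is left e then projT1 (cid e) else f.

Lemma fps_mulVf : {in fps_unit, left_inverse 1 fps_inv *%R}.
Proof. by move=> f /asboolP u; rewrite /fps_inv; case: pselect => // e; case: cid. Qed.
Lemma fps_unitP f g : g * f = 1 -> fps_unit f.
Proof. by move=> e; apply/asboolP; exists g. Qed.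
Lemma fps_inv_out : {in [predC fps_unit], fps_inv =1 id}.
Proof. by move=> f /asboolP u; rewrite /fps_inv; case: pselect. Qed.
HB.instance Definition _ := GRing.ComNzRing_hasMulInverse.Build (fps R)
  fps_mulVf fps_unitP fps_inv_out.

End FpsBasics.

Lemma fps_unitE (F : fieldType) (f : fps F) : fps_coef0 f != 0 -> f \is a GRing.unit.
Proof.
move=> nz; apply/asboolP.
by apply: (@fps_inverse _ f (fps_coef0 f)^-1); rewrite mulVf.
Qed.

Lemma fps_unit_coef0 (R : comUnitRingType) (f : fps R) :
  fps_coef0 f \is a GRing.unit -> f \is a GRing.unit.
Proof.
by move=> u; apply/asboolP; apply: (@fps_inverse _ f (fps_coef0 f)^-1); rewrite mulVr.
Qed.

Lemma fps_idomain (R : idomainType) : GRing.integral_domain_axiom (fps R).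
Proof.
move=> f g fg0; apply/norP => -[/fps_order[m [f' [fE f0]]] /fps_order[n [g' [gE g0]]]].
have /(@fpsXn_inj _ (m + n) _ 0) : fpsX ^+ (m + n) * (f' * g') = fpsX ^+ (m + n) * 0.
  by rewrite mulr0 -fg0 fE gE exprD mulrACA.
move/(congr1 (@fps_coef0 _)); rewrite fps_coef0M rmorph0 => /eqP.
by rewrite mulf_eq0 (negPf f0) (negPf g0).
Qed.
HB.instance Definition _ (R : idomainType) :=
  GRing.ComUnitRing_isIntegral.Build (fps R) (@fps_idomain R).

Lemma fps_field_order (F : fieldType) (f : fps F) : f != 0 ->
  exists m u, f = fpsX ^+ m * u /\ u \is a GRing.unit.
Proof. by move=> /fps_order[m [u [-> u0]]]; exists m, u; split; rewrite ?fps_unitE. Qed.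

(* Divisibility form of: an element p / s of the fraction field all of whose
   powers have the common denominator d lies in the ring. *)
Definition completely_integrally_closed (R : comNzRingType) : Prop :=
  forall p s d : R, s != 0 -> d != 0 ->
    (forall n, exists g, d * p ^+ n = s ^+ n * g) -> exists t, p = s * t.

Lemma field_completely_integrally_closed (F : fieldType) :
  completely_integrally_closed F.
Proof. by move=> p s d s0 _ _; exists (s^-1 * p); rewrite mulrA mulfV ?mul1r. Qed.

Section FpsClosed.
Variable R : idomainType.
Hypothesis cicR : completely_integrally_closed R.
Implicit Types p s d f g : fps R.

Lemma fpsXn_dvd_cancel s m f g : fps_coef0 s != 0 ->
  s * g = fpsX ^+ m * f -> exists g', g = fpsX ^+ m * g'.
Proof.
move=> s0; elim: m f g => [|m IH] f g e; first by exists g; rewrite mul1r.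
have [|g1 gE] := @fps_coef0_eq0 _ g.
  have := congr1 (@fps_coef0 _) e.
  rewrite exprS -mulrA !fps_coef0M fps_coef0X mul0r => /eqP.
  by rewrite mulf_eq0 (negPf s0) => /eqP.
have [|g2 g1E] := IH f g1; last by exists g2; rewrite gE g1E exprS mulrA.
by apply: (@fpsX_inj R); rewrite /= [RHS]mulrA -exprS -e gE mulrCA.
Qed.

(** Divide [p] by [s], where [div] returns remainder 0 exactly on multiples of the constant term
    s_0. If the remainder r is nonzero, closedness of [R] makes its lowest coefficient a multiple of
    s_0, and such a coefficient cannot survive the division. *)
Lemma fps_cic_unitary p s d : fps_coef0 s != 0 -> d != 0 ->
  (forall n, exists g, d * p ^+ n = s ^+ n * g) -> exists t, p = s * t.
Proof.
move=> s0 d0 dvd.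
have divP a : exists qr : R * R, a = qr.1 * fps_coef0 s + qr.2 /\
    ((exists b, a = fps_coef0 s * b) -> qr.2 = 0).
  case: (pselect (exists b, a = fps_coef0 s * b)) => [[b ab]|nb].
    by exists (b, 0); rewrite addr0 mulrC; split.
  by exists (0, a); split=> [|/nb//]; rewrite mul0r add0r.
have [div divE] := choice divP.
have [a|q [r [pE rE]]] := @fps_division _ s div _ p; first by case: (divE a).
exists q; rewrite pE mulrC (_ : r = 0) ?addr0 //; apply/eqP; apply: contrapT => /negP r0.
(* The hypothesis on p is inherited by r = p - q s, by the binomial formula. *)
have rdvd n : exists g, d * r ^+ n = s ^+ n * g.
  have -> : r = p - q * s by rewrite pE addrC addKr.
  have [g gE] := choice dvd.
  exists (\sum_(i < n.+1) g (n - i)%N * (- q) ^+ i *+ 'C(n, i)).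
  rewrite exprDn !mulr_sumr; apply: eq_bigr => i _.
  have lein : (i <= n)%N by rewrite -ltnS.
  rewrite !mulrnAr; congr (_ *+ _).
  have -> : s ^+ n = s ^+ (n - i) * s ^+ i by rewrite -exprD subnK.
  by rewrite [LHS]mulrA gE -mulNr exprMn; ring.
have [m [d' [dE d'0]]] := fps_order d0; have [N [r' [rE' r'0]]] := fps_order r0.
(* Comparing lowest terms in [d * r ^+ n = s ^+ n * g] carries the divisibility down to [R], with
   the lowest coefficient of [d] as common denominator. *)
have [t tE] : exists t, fps_coef0 r' = fps_coef0 s * t.
  apply: (cicR s0 d'0) => n; have [g e] := rdvd n.
  have E : s ^+ n * g = fpsX ^+ (m + N * n) * (d' * r' ^+ n).
    by rewrite -e dE rE' exprMn -exprM exprD mulrACA.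
  have [|g' gE] := fpsXn_dvd_cancel _ E; first by rewrite fps_coef0Xn expf_neq0.
  exists (fps_coef0 g'); rewrite -!fps_coef0Xn -!fps_coef0M; congr (fps_coef0 _).
  by apply: (@fpsXn_inj R (m + N * n)); rewrite -E gE mulrCA.
have rN : r N = fps_coef0 r' by rewrite rE' fpsXnM ltnn subnn.
have : r N = 0.
  rewrite rE; apply: (divE _).2; exists (q N + t).
  by rewrite rN tE mulrDr [in RHS]mulrC.
by rewrite rN => /eqP; rewrite (negPf r'0).
Qed.

(** Powers of the variable are removed first: the order e of [s] is at most the order l of [p],
    after which [s] may be taken with nonzero constant term. *)
Lemma fps_completely_integrally_closed : completely_integrally_closed (fps R).
Proof.
move=> p s d s0 d0 dvd.
have [->|p0] := eqVneq p 0; first by exists 0; rewrite mulr0.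
have [e [s' [sE s'0]]] := fps_order s0; have [l [p' [pE p'0]]] := fps_order p0.
have [m [d' [dE d'0]]] := fps_order d0.
have lel : (e <= l)%N.
  rewrite leqNgt; apply/negP => ltle.
  (* Exponent m + 1 exceeds the order m of [d]: if l < e, the left side has order m + l(m + 1),
     which is less than e(m + 1). *)
  have [g gE] := dvd m.+1.
  have /eqP := congr1 (fun f => f (m + l * m.+1)%N) gE.
  rewrite dE pE sE !exprMn -!exprM mulrACA -exprD -mulrA !fpsXnM ltnn subnn.
  have -> : (m + l * m.+1 < e * m.+1)%N.
    by rewrite (@leq_trans (l.+1 * m.+1)) ?leq_mul2r ?ltle ?orbT // mulSn -addSn.
  rewrite -[_ 0%N]/(fps_coef0 _) fps_coef0M fps_coef0Xn mulf_eq0 (negPf d'0).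
  by rewrite expf_eq0 (negPf p'0).
have [||n|t tE] := @fps_cic_unitary (fpsX ^+ (l - e) * p') s' d => //.
  have [g gE] := dvd n; exists g; apply: (@fpsXn_inj R (e * n)).
  rewrite /= [RHS]mulrA !exprM -exprMn -sE -gE mulrCA -exprMn.
  by rewrite [_ * (_ * p')]mulrA -exprD subnKC // -pE.
by exists t; rewrite sE -mulrA -tE mulrA -exprD subnKC.
Qed.

End FpsClosed.

(** * Regular sequences and the Koszul complex *)

Lemma addr_cross (V : zmodType) (x y z t : V) : x + y = z + t -> x - z = t - y.
Proof. by move=> e; apply/eqP; rewrite subr_eq addrC addrA -e addrK. Qed.

Section RegularPairs.
Variables (A : comNzRingType) (M : lmodType A).
Implicit Types (a b c w z : A) (m n p q : M).

Definition mod_regular a : Prop := forall m, a *: m = 0 -> m = 0.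

(** A regular sequence of length two without the condition M <> (a, b)M. *)
Definition regular_pair a b : Prop :=
  mod_regular a /\ forall m p, b *: m = a *: p -> exists q, m = a *: q.

Lemma mod_regular_inj a : mod_regular a -> injective ( *:%R a : M -> M).
Proof.
by move=> ra m n /eqP; rewrite -subr_eq0 -scalerBr => /eqP/ra/eqP; rewrite subr_eq0 => /eqP.
Qed.

Lemma scaler_swap a b m : a *: (b *: m) = b *: (a *: m).
Proof. by rewrite !scalerA mulrC. Qed.

(** Every relation between [a] and [b] on M is a Koszul relation, in a form symmetric in the two
    elements. *)
Lemma regular_pair_sym a b m n : regular_pair a b ->
  a *: m = b *: n -> exists q, m = b *: q /\ n = a *: q.
Proof.
move=> [ra rb] e; have [q nE] := rb n m (esym e).
by exists q; split=> //; apply: (mod_regular_inj ra); rewrite e nE scaler_swap.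
Qed.

Lemma in_seq_mul0 m : in_seq_mul [::] m <-> m = 0.
Proof.
split=> [[c]|->]; first by rewrite big_ord0.
by exists (fun=> 0); rewrite big_ord0.
Qed.

Lemma in_seq_mul1 a m : in_seq_mul [:: a] m <-> exists p, m = a *: p.
Proof.
split=> [[c]|[p ->]]; first by rewrite big_ord1 => ->; exists (c 0%N).
by exists (fun=> p); rewrite big_ord1.
Qed.

Lemma in_seq_mul2 a b m :
  in_seq_mul [:: a; b] m <-> exists p q, m = a *: p + b *: q.
Proof.
split=> [[c]|[p [q ->]]].
  by rewrite big_ord_recl big_ord1 => ->; exists (c 0%N), (c 1%N).
by exists (nth 0 [:: p; q]); rewrite big_ord_recl big_ord1.
Qed.

Lemma regular_sequence_pair a b s :
  regular_sequence M (a :: b :: s) -> regular_pair a b.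
Proof.
move=> [reg _]; split=> [m am|m p bm].
  by have := reg 0%N isT m; rewrite /= !in_seq_mul0; apply.
have := reg 1%N isT m; rewrite /= ?take0 !in_seq_mul1; apply.
by exists p.
Qed.

Lemma regular_sequence_third a b c s m p q :
    regular_sequence M [:: a, b, c & s] -> c *: m = a *: p + b *: q ->
  exists p' q', m = a *: p' + b *: q'.
Proof.
move=> [reg _] e; have := reg 2%N isT m.
rewrite /= ?take0 !in_seq_mul2; apply.
by exists p, q.
Qed.

Lemma regular_pair_sequence a b : regular_pair a b ->
  (exists m, forall p q, m <> a *: p + b *: q) -> regular_sequence M [:: a; b].
Proof.
move=> [ra rb] [m mN]; split; last first.
  by exists m; rewrite in_seq_mul2 => -[p [q e]]; apply: (mN p q).
move=> [|[|//]] _ n /=; first by rewrite !in_seq_mul0; apply: ra.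
by rewrite !in_seq_mul1 => -[p]; apply: rb.
Qed.

Lemma mod_regularM a b : mod_regular a -> mod_regular b -> mod_regular (a * b).
Proof. by move=> ra rb m; rewrite -scalerA => /ra/rb. Qed.

Lemma regular_pair_sqr a b : regular_pair a b -> regular_pair (a * a) (b * b).
Proof.
move=> [ra rb]; have rbb m p : (b * b) *: m = a *: p -> exists q, m = a *: q.
  by rewrite -scalerA => /rb[q /rb].
split=> [|m p e]; first exact: mod_regularM.
have [|q mE] := rbb m (a *: p); first by rewrite e scalerA.
have /rbb[q' qE] : (b * b) *: q = a *: p.
  by apply: (mod_regular_inj ra); rewrite scaler_swap -mE e scalerA.
by exists q'; rewrite mE qE scalerA.
Qed.

(** The elements are squared one at a time, [a] in [rc1] and then [b]. A relation modulo the square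
    is read modulo the element itself, and [regular_pair_sym] turns the difference into a second
    relation of the same kind. *)
Lemma regular_triple_sqr a b c :
    regular_pair a b ->
    (forall m p q, c *: m = a *: p + b *: q -> exists p' q', m = a *: p' + b *: q') ->
  forall m p q, c *: m = (a * a) *: p + (b * b) *: q ->
    exists p' q', m = (a * a) *: p' + (b * b) *: q'.
Proof.
move=> rab rc; have [ra rb] := rab.
have rc1 m p q : c *: m = (a * a) *: p + b *: q ->
    exists p' q', m = (a * a) *: p' + b *: q'.
  move=> e; have [|p1 [q1 mE]] := rc m (a *: p) q; first by rewrite scalerA.
  have [|t [t1 t2]] := @regular_pair_sym a b (c *: p1 - a *: p) (q - c *: q1) rab.
    rewrite !scalerBr; apply: addr_cross.
    by rewrite (scalerA a a) -e mE scalerDr !(scaler_swap c).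
  have [|p2 [q2 p1E]] := rc p1 p t; first by rewrite -t1 addrCA subrr addr0.
  exists p2, (a *: q2 + q1).
  by rewrite mE p1E scalerDr scalerA scalerDr scaler_swap addrA.
move=> m p q e.
have [|p1 [q1 mE]] := rc1 m p (b *: q); first by rewrite scalerA.
have raab : regular_pair (a * a) b.
  split=> [|n p' e']; first exact: mod_regularM.
  have [|n1 nE] := rb n (a *: p'); first by rewrite scalerA.
  have [|n2 n1E] := rb n1 p'; last by exists n2; rewrite nE n1E scalerA.
  by apply: (mod_regular_inj ra); rewrite scaler_swap -nE e' scalerA.
have [|t [t1 t2]] := @regular_pair_sym (a * a) b (c *: p1 - p) (b *: q - c *: q1) raab.
  rewrite !scalerBr; apply: addr_cross.
  by rewrite (scalerA b b) -e mE scalerDr !(scaler_swap c).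
have [|p2 [q2 q1E]] := rc1 q1 (- t) q.
  by rewrite scalerN -t2 opprB subrK.
exists (p1 + b *: p2), q2.
by rewrite mE q1E !scalerDr [b *: (_ *: p2)]scaler_swap addrA (scalerA b b).
Qed.

(* Multiplication by the transition determinant embeds M / (w, z) M into
   M / (a, b) M. *)
Lemma transition_det_inj w z a b al be ga de m p q :
    mod_regular w -> regular_pair a b ->
    a = w * al + z * be -> b = w * ga + z * de ->
    (al * de - be * ga) *: m = a *: p + b *: q ->
  exists p' q', m = w *: p' + z *: q'.
Proof.
move=> rw rab aE bE e; have [ra _] := rab.
have [|t [t1 t2]] := @regular_pair_sym a b (de *: m - w *: p) (be *: m + w *: q) rab.
  have E : (a * de) *: m - (b * be) *: m = w *: (a *: p + b *: q).
    by rewrite -e scalerA -scalerBl; congr (_ *: _); rewrite aE bE; ring.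
  rewrite scalerBr scalerDr !scalerA; apply/eqP.
  by rewrite subr_eq -addrA addrC -subr_eq E scalerDr !scalerA addrC !(mulrC w).
have bem : be *: (m - z *: t) = w *: (al *: t - q).
  rewrite !scalerBr (_ : be *: m = a *: t - w *: q); last by rewrite -t2 addrK.
  by rewrite aE scalerDl !scalerA [be * z]mulrC addrAC addrK.
have dem : de *: (m - z *: t) = w *: (ga *: t + p).
  rewrite scalerBr scalerDr (_ : de *: m = b *: t + w *: p); last by rewrite -t1 subrK.
  by rewrite bE scalerDl !scalerA [de * z]mulrC addrAC addrK.
pose u := al *: (m - z *: t) + z *: (al *: t - q).
have am : a *: (m - z *: t) = w *: u.
  by rewrite {1}aE scalerDl -!scalerA bem (scaler_swap z w) -scalerDr.
pose v := ga *: (m - z *: t) + z *: (ga *: t + p).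
have bm : b *: (m - z *: t) = w *: v.
  by rewrite {1}bE scalerDl -!scalerA dem (scaler_swap z w) -scalerDr.
have [|s [s1 s2]] := @regular_pair_sym a b v u rab.
  by apply: (mod_regular_inj rw); rewrite !(scaler_swap w) -bm -am scaler_swap.
exists s, t; apply/eqP; rewrite -subr_eq; apply/eqP.
by apply: (mod_regular_inj ra); rewrite am s2 scaler_swap.
Qed.

(* Depth at least two kills the Koszul homology of a parameter ideal (w, z)
   containing a and b. *)
Lemma koszul_soc w z a al be m :
  mod_regular a -> a = w * al + z * be -> w *: m = 0 -> z *: m = 0 -> m = 0.
Proof.
move=> ra aE wm zm; apply: ra.
by rewrite aE scalerDl -!scalerA (scaler_swap w) (scaler_swap z) wm zm !scaler0 addr0.
Qed.

(** [a] and [b] carry the cycle (m1, m2) to the boundaries of [u] and [v]. Then b u - a v is killed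
    by w and z, hence is zero by [koszul_soc], and regularity writes u = a n; cancelling [a] shows
    that the cycle is the boundary of n. *)
Lemma koszul_H1 w z a b al be ga de m1 m2 :
    regular_pair a b -> a = w * al + z * be -> b = w * ga + z * de ->
    w *: m1 = z *: m2 ->
  exists n, m1 = z *: n /\ m2 = w *: n.
Proof.
move=> rab aE bE e; have [ra rb] := rab.
pose u := al *: m2 + be *: m1; pose v := ga *: m2 + de *: m1.
have am1 : a *: m1 = z *: u.
  by rewrite aE scalerDl scalerDr -!scalerA !(scaler_swap w) e !(scaler_swap z).
have bm1 : b *: m1 = z *: v.
  by rewrite bE scalerDl scalerDr -!scalerA !(scaler_swap w) e !(scaler_swap z).
have am2 : a *: m2 = w *: u.
  by rewrite aE scalerDl scalerDr -!scalerA !(scaler_swap z) -e !(scaler_swap w).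
have bm2 : b *: m2 = w *: v.
  by rewrite bE scalerDl scalerDr -!scalerA !(scaler_swap z) -e !(scaler_swap w).
have buav : b *: u = a *: v.
  apply/eqP; rewrite -subr_eq0; apply/eqP; apply: (koszul_soc ra aE).
    by rewrite scalerBr !(scaler_swap w) -am2 -bm2 scaler_swap subrr.
  by rewrite scalerBr !(scaler_swap z) -am1 -bm1 scaler_swap subrr.
have [n uE] := rb _ _ buav.
by exists n; split; apply: (mod_regular_inj ra); rewrite scaler_swap -uE.
Qed.

End RegularPairs.

(** * The fibre product of two copies of k[[z]][[w]] *)

Lemma mulmx_inj (R : comNzRingType) m n (B C : 'M[R]_(m, n)) :
  (forall v : 'cV[R]_n, B *m v = C *m v) -> B = C.
Proof.
move=> h; apply/matrixP => i j; have /matrixP/(_ i 0) := h (delta_mx j 0).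
by rewrite -!colE !mxE.
Qed.

Section TwoVariables.
Variable k : fieldType.
Local Notation R := (fps (fps k)).
Implicit Types (p q r : R).

Definition RW : R := fpsX.
Definition RZ : R := fpsC fpsX.
Definition residue r : k := fps_coef0 (fps_coef0 r).

Lemma residueD p q : residue (p + q) = residue p + residue q. Proof. by []. Qed.
Lemma residueM p q : residue (p * q) = residue p * residue q.
Proof. by rewrite /residue !fps_coef0M. Qed.

Lemma residue_unit r : residue r != 0 -> r \is a GRing.unit.
Proof. by move=> /fps_unitE/fps_unit_coef0. Qed.

Lemma residue_eq0 r : residue r = 0 -> exists p q, r = RW * p + RZ * q.
Proof.
have [g rE] := fps_split r; move/fps_coef0_eq0 => [h hE].
exists g, (fpsC h); rewrite {1}rE addrC; congr (_ + _).
by rewrite hE; apply: (rmorphM (@fpsC (fps k))).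
Qed.

(** Membership in the j-th power of the maximal ideal (w, z), expressed by coefficients;
    [vanishes_eq0] then plays the role of Krull's intersection theorem. *)
Definition vanishes j r : Prop := forall a b, (a + b < j)%N -> r a b = 0.

Lemma vanishesD j p q : vanishes j p -> vanishes j q -> vanishes j (p + q).
Proof. by move=> vp vq a b lt; rewrite !fpsD vp ?vq ?addr0. Qed.

Lemma vanishesW j r : vanishes j r -> vanishes j.+1 (RW * r).
Proof. by move=> vr [|a] b lt; rewrite fpsXM //; apply: vr. Qed.

Lemma vanishesZ j r : vanishes j r -> vanishes j.+1 (RZ * r).
Proof. by move=> vr a [|b] lt; rewrite fpsCM fpsXM //; apply: vr; rewrite addnS in lt. Qed.

Lemma vanishes_eq0 r : (forall j, vanishes j r) -> r = 0.
Proof. by move=> v; apply: fpsP => a; apply: fpsP => b; apply: (v (a + b).+1). Qed.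

Lemma fps_coef0_Zn_inj n p q :
  fps_coef0 (RZ ^+ n * p) = fps_coef0 (RZ ^+ n * q) -> fps_coef0 p = fps_coef0 q.
Proof. by rewrite !fps_coef0M fps_coef0Xn fps_coef0C => /fpsXn_inj. Qed.

Lemma RZ_neq0 n : RZ ^+ n != 0.
Proof.
rewrite expf_neq0 //; apply/eqP => /(congr1 (@fps_coef0 _))/eqP.
by rewrite rmorph0 (negPf (fpsX_neq0 _)).
Qed.

Lemma coef0_RZ_neq0 n : fps_coef0 (RZ ^+ n) != 0.
Proof. by rewrite fps_coef0Xn expf_neq0 // fpsX_neq0. Qed.

(** Coprimality of w and z^n: w is prime and z^n is nonzero modulo w. *)
Lemma W_Z_cancel n p q : RZ ^+ n * p = RW * q -> exists t, p = RW * t /\ q = RZ ^+ n * t.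
Proof.
move=> e; have [|t pE] := @fps_coef0_eq0 _ p.
  have := congr1 (@fps_coef0 _) e.
  rewrite !fps_coef0M fps_coef0Xn fps_coef0C mul0r => /eqP.
  by rewrite mulf_eq0 expf_eq0 (negPf (fpsX_neq0 _)) andbF => /eqP.
exists t; split=> //; apply: (@fpsX_inj (fps k)).
by rewrite -[LHS]e pE mulrCA.
Qed.

Section FibreProduct.
Variable A : comNzRingType.

(** [fps_coef0] is reduction modulo w, so this says that A is the ring of pairs in R x R that agree
    in k[[z]]. *)
Definition fibre_product (n1 n2 : {rmorphism A -> R}) : Prop :=
  [/\ forall a, fps_coef0 (n1 a) = fps_coef0 (n2 a),
      forall r1 r2, fps_coef0 r1 = fps_coef0 r2 -> exists a, n1 a = r1 /\ n2 a = r2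
    & forall a b, n1 a = n1 b -> n2 a = n2 b -> a = b].

Lemma fibre_product_sym n1 n2 : fibre_product n1 n2 -> fibre_product n2 n1.
Proof.
move=> [h1 h2 h3]; split=> [a|r1 r2 e|a b e1 e2]; [by rewrite h1| |exact: h3].
by have [a [? ?]] := h2 r2 r1 (esym e); exists a.
Qed.

(** The element of A with components r1 and r2; the default 0 is returned when these do not agree
    modulo w. *)
Definition fp_lift (n1 n2 : {rmorphism A -> R}) r1 r2 : A :=
  if pselect (exists a, n1 a = r1 /\ n2 a = r2) is left e then projT1 (cid e) else 0.

Variables n1 n2 : {rmorphism A -> R}.
Hypothesis fpA : fibre_product n1 n2.
Local Notation lift := (fp_lift n1 n2).

Lemma fp_coef0 a : fps_coef0 (n1 a) = fps_coef0 (n2 a).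
Proof. by case: fpA. Qed.

Lemma fp_eq a b : n1 a = n1 b -> n2 a = n2 b -> a = b.
Proof. by case: fpA => _ _; apply. Qed.

Lemma fp_liftP r1 r2 : fps_coef0 r1 = fps_coef0 r2 ->
  n1 (lift r1 r2) = r1 /\ n2 (lift r1 r2) = r2.
Proof.
case: fpA => _ h _ /h e; rewrite /fp_lift.
by case: pselect => // e'; case: cid.
Qed.
Lemma fp_lift1 r1 r2 : fps_coef0 r1 = fps_coef0 r2 -> n1 (lift r1 r2) = r1.
Proof. by case/fp_liftP. Qed.
Lemma fp_lift2 r1 r2 : fps_coef0 r1 = fps_coef0 r2 -> n2 (lift r1 r2) = r2.
Proof. by case/fp_liftP. Qed.

Lemma fp_lift_sym r1 r2 : fps_coef0 r1 = fps_coef0 r2 -> lift r1 r2 = fp_lift n2 n1 r2 r1.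
Proof.
move=> e; apply: fp_eq.
  rewrite fp_lift1 // /fp_lift; case: pselect => [e'|[]].
    by case: cid => /= a [].
  by case: fpA => _ /(_ _ _ e)[a [? ?]] _; exists a.
rewrite fp_lift2 // /fp_lift; case: pselect => [e'|[]].
  by case: cid => /= a [].
by case: fpA => _ /(_ _ _ e)[a [? ?]] _; exists a.
Qed.

Definition diag r : A := lift r r.
Local Notation x := (lift RW 0).
Local Notation w := (diag RW).
Local Notation z := (diag RZ).

Lemma diag1 r : n1 (diag r) = r. Proof. exact: fp_lift1. Qed.
Lemma diag2 r : n2 (diag r) = r. Proof. exact: fp_lift2. Qed.
Lemma lift_x1 : n1 x = RW. Proof. exact: fp_lift1. Qed.
Lemma lift_x2 : n2 x = 0. Proof. exact: fp_lift2. Qed.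

Lemma diagD p q : diag (p + q) = diag p + diag q.
Proof. by apply: fp_eq; rewrite rmorphD ?diag1 ?diag2. Qed.
Lemma diagM p q : diag (p * q) = diag p * diag q.
Proof. by apply: fp_eq; rewrite rmorphM ?diag1 ?diag2. Qed.
Lemma diagN p : diag (- p) = - diag p.
Proof. by apply: fp_eq; rewrite rmorphN ?diag1 ?diag2. Qed.
Lemma diag_0 : diag 0 = 0.
Proof. by apply: fp_eq; rewrite rmorph0 ?diag1 ?diag2. Qed.
Lemma diag_1 : diag 1 = 1.
Proof. by apply: fp_eq; rewrite rmorph1 ?diag1 ?diag2. Qed.

Lemma fp_decomp a : exists q, n1 a - n2 a = RW * q.
Proof.
apply: fps_coef0_eq0; rewrite rmorphB /= fp_coef0; exact: subrr.
Qed.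

Lemma fp_decompE a q : n1 a - n2 a = RW * q -> a = diag (n2 a) + x * diag q.
Proof.
move=> e; apply: fp_eq; rewrite rmorphD rmorphM ?diag1 ?diag2.
  by rewrite lift_x1 -e addrC subrK.
by rewrite lift_x2 mul0r addr0.
Qed.

Lemma fp_inverse a : residue (n1 a) != 0 -> exists b, a * b = 1.
Proof.
move=> a1; have a2 : residue (n2 a) != 0 by rewrite /residue -fp_coef0.
exists (lift (n1 a)^-1 (n2 a)^-1).
have e : fps_coef0 (n1 a)^-1 = fps_coef0 (n2 a)^-1.
  apply: (@mulfI _ (fps_coef0 (n1 a))).
    by apply: contraNneq a1; rewrite /residue => ->.
  rewrite -fps_coef0M divrr ?residue_unit // fp_coef0 -fps_coef0M.
  by rewrite divrr ?residue_unit.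
by apply: fp_eq; rewrite rmorphM rmorph1 ?fp_lift1 ?fp_lift2 ?divrr ?residue_unit.
Qed.

Lemma fp_nonunitP a : nonunit a <-> residue (n1 a) = 0.
Proof.
split=> [na|a0 [b ab]].
  by apply/eqP; apply: contrapT => /negP/fp_inverse; apply: na.
have := congr1 (fun c => residue (n1 c)) ab.
rewrite rmorphM rmorph1 residueM a0 mul0r => /eqP.
by rewrite eq_sym oner_eq0.
Qed.

Lemma nonunit_diag r : residue r = 0 -> nonunit (diag r).
Proof. by move=> r0; apply/fp_nonunitP; rewrite diag1. Qed.

(** Write a = s + x t with s in (w, z) and t in the image of [diag]. In a^2 the only term not
    visibly in (w, z) is x^2 t^2 = w x t^2. *)
Lemma fp_sqr a : nonunit a -> exists p q : A, a * a = w * p + z * q.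
Proof.
move/fp_nonunitP; rewrite /residue fp_coef0 => /residue_eq0[p [q e]].
have [t /fp_decompE aE] := fp_decomp a.
exists (diag p * (a + x * diag t) + x * diag t * diag t),
  (diag q * (a + x * diag t)).
have xx : x * x = w * x.
  by apply: fp_eq; rewrite !rmorphM ?diag1 ?diag2 ?lift_x1 ?lift_x2 ?mulr0.
rewrite {1 2}aE e diagD !diagM.
have -> : a = w * diag p + z * diag q + x * diag t by rewrite -!diagM -diagD -e.
rewrite [RHS](_ : _ = (w * diag p + z * diag q) * (w * diag p + z * diag q + x * diag t *+ 2)
  + w * x * (diag t * diag t)); last by ring.
rewrite -xx; ring.
Qed.

(** For a regular triple a, b, c, the transition determinant from (w, z) to (a^2, b^2) would map M
    into (a^2, b^2)M, although it is injective from M / (w, z)M to M / (a^2, b^2)M and the former is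
    nonzero. *)
Lemma depth_le2 (M : lmodType A) s :
    mod_regular M w -> (exists m : M, forall m1 m2, m <> w *: m1 + z *: m2) ->
  regular_sequence_in_max M s -> (size s <= 2)%N.
Proof.
move=> rw [m mN] [nu rs]; case: s => [|a [|b [|c s]]] // in nu rs *; exfalso.
have [al [be aE]] := fp_sqr (nu a (mem_head _ _)).
have [ga [de bE]] := fp_sqr (nu b (mem_nth 0 (isT : (1 < size [:: a, b, c & s])%N))).
have [ep [ze cE]] := fp_sqr (nu c (mem_nth 0 (isT : (2 < size [:: a, b, c & s])%N))).
have rab := regular_sequence_pair rs.
have rc := regular_triple_sqr rab
  (fun m (p q : M) => @regular_sequence_third _ _ a b c s m p q rs).
(* By Cramer's rule the determinant times w or z lies in (a^2, b^2), hence so does its product with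
   c^2; this is the source of the coefficients. Then [c] is cancelled twice. *)
have [|p1 [q1 /rc[p2 [q2 e]]]] :=
    rc (c *: ((al * de - be * ga) *: m)) ((ep * de - ze * ga) *: m) ((ze * al - ep * be) *: m).
  rewrite !scalerA -scalerDl; congr (_ *: _).
  by rewrite cE aE bE; ring.
have [p [q]] := transition_det_inj rw (regular_pair_sqr rab) aE bE e.
exact: mN.
Qed.

Lemma cohen_macaulayI (M : lmodType A) :
    has_krull_dim A 2 -> finitely_generated M -> regular_pair M w z ->
    (exists m : M, forall m1 m2, m <> w *: m1 + z *: m2) ->
  cohen_macaulay M.
Proof.
move=> dimA fgM rwz mN; split=> //; exists 2%N => //; split; last first.
  by move=> s; apply: depth_le2 => //; case: rwz.
exists [:: w; z] => //; split; last exact: regular_pair_sequence.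
by move=> a; rewrite !inE => /orP[] /eqP ->; apply: nonunit_diag.
Qed.

(** * Freeness over k[[z]][[w]] *)

Section Basis.
Variable M : lmodType A.

Definition comb n (e : 'I_n -> M) (c : 'cV[R]_n) : M := \sum_i diag (c i 0) *: e i.

Lemma combD n (e : 'I_n -> M) c d : comb e (c + d) = comb e c + comb e d.
Proof. by rewrite -big_split; apply: eq_bigr => i _; rewrite mxE diagD scalerDl. Qed.

Lemma combB n (e : 'I_n -> M) c d : comb e (c - d) = comb e c - comb e d.
Proof.
rewrite combD; congr (_ + _); rewrite -sumrN; apply: eq_bigr => i _.
by rewrite mxE diagN scaleNr.
Qed.

Lemma combZ n (e : 'I_n -> M) p c : comb e (p *: c) = diag p *: comb e c.
Proof. by rewrite scaler_sumr; apply: eq_bigr => i _; rewrite mxE diagM scalerA. Qed.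

Definition spans n (e : 'I_n -> M) : Prop := forall m, exists c, m = comb e c.

Lemma finitely_generated_spans : finitely_generated M -> exists n (e : 'I_n -> M), spans e.
Proof.
move=> [n [e eP]]; exists (n + n)%N.
exists (fun i => match split i with inl j => e j | inr j => x *: e j end) => m.
have [c ->] := eP m; have [q qE] := choice (fun i => fp_decomp (c i)).
exists (col_mx (\col_i n2 (c i)) (\col_i q i)).
rewrite /comb big_split_ord /= -big_split; apply: eq_bigr => i _ /=.
rewrite col_mxEu col_mxEd !mxE (unsplitK (inl i)) (unsplitK (inr i)).
by rewrite scalerA mulrC -scalerDl -fp_decompE.
Qed.

(** In a spanning family of least size no relation has a unit coefficient, since it would eliminate
    a generator. *)
Lemma minimal_spans : finitely_generated M ->
  exists n (e : 'I_n -> M), spans e /\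
    forall c, comb e c = 0 -> forall i, residue (c i 0) = 0.
Proof.
move=> /finitely_generated_spans ex.
have ex' : exists n, `[< exists e : 'I_n -> M, spans e >].
  by case: ex => n ?; exists n; apply/asboolP.
case: (ex_minnP ex') => n /asboolP[e se] min; exists n, e; split=> // c c0 i.
apply/eqP; apply: contrapT => /negP ci.
case: n => [|n] in e se min c c0 i ci *; first by case: i ci.
suff /min : `[< exists e : 'I_n -> M, spans e >] by rewrite ltnn.
apply/asboolP; exists (fun j => e (fintype.lift i j)) => m.
(* Subtracting this multiple of the relation makes the i-th coordinate vanish. *)
have [d ->] := se m; pose d' := d - (d i 0 / c i 0) *: c.
have -> : comb e d = comb e d'.
  by rewrite /d' -scaleNr combD combZ c0 scaler0 addr0.
exists (\col_j d' (fintype.lift i j) 0); rewrite /comb (bigD1_ord i) //=.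
rewrite !mxE divrK ?residue_unit // subrr diag_0 scale0r add0r.
by apply: eq_bigr => j _; rewrite !mxE.
Qed.

(** A relation among minimal generators has the form c = w p + z q. By [koszul_H1], [p] and [q]
    become relations themselves after adding -z d and w d, which does not change c. So the relations
    K satisfy K = (w, z)K, and every coefficient vanishes to all orders. *)
Lemma regular_pair_basis a b :
    finitely_generated M -> nonunit a -> nonunit b -> regular_pair M a b ->
  exists n (e : 'I_n -> M), bijective (comb e).
Proof.
move=> /minimal_spans[n [e [se min]]] /fp_sqr[al [be aE]] /fp_sqr[ga [de bE]] rab.
exists n, e.
have H1 := koszul_H1 (regular_pair_sqr rab) aE bE.
have ker j : forall c, comb e c = 0 -> forall i, vanishes j (c i 0).
  elim: j => [|j IH] c c0 i //.
  have [p pE] := choice (fun i => residue_eq0 (min c c0 i)).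
  have [q qE] := choice pE.
  have cE : c = RW *: \col_i p i + RZ *: \col_i q i.
    by apply/matrixP => l l'; rewrite !ord1 !mxE; apply: qE.
  have [|m [e1 e2]] := H1 (comb e (\col_i p i)) (- comb e (\col_i q i)).
    by apply/eqP; rewrite scalerN -addr_eq0 -!combZ -combD -cE c0.
  have [d mE] := se m.
  have k1 : comb e (\col_i p i - RZ *: d) = 0 by rewrite combB combZ -mE e1 subrr.
  have k2 : comb e (\col_i q i + RW *: d) = 0 by rewrite combD combZ -mE -e2 subrr.
  have := IH _ k1 i; have := IH _ k2 i; rewrite !mxE => /vanishesZ vq /vanishesW vp.
  rewrite (_ : c i 0 = RW * (p i - RZ * d i 0) + RZ * (q i + RW * d i 0)).
    exact: vanishesD.
  by rewrite qE; ring.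
have inj : injective (comb e).
  move=> c d cd; apply/eqP; rewrite -subr_eq0; apply/eqP/matrixP => i l.
  rewrite ord1 [RHS]mxE; apply: vanishes_eq0 => j; apply: ker.
  by rewrite combB cd subrr.
have [g gE] := choice se; exists g => [c|m]; last by rewrite -gE.
by apply: inj; rewrite -gE.
Qed.

End Basis.
End FibreProduct.
End TwoVariables.

(** * Splitting off an ideal *)

Section Splitting.
Variable A : comNzRingType.
Implicit Types M N B : lmodType A.

Lemma inj_surj_bij (T U : Type) (f : T -> U) :
  injective f -> (forall u, exists t, u = f t) -> bijective f.
Proof.
move=> inj surj; have [g gE] := choice surj.
by exists g => [t|u]; [apply: inj; rewrite -gE | rewrite -gE].
Qed.

Definition linear_of M N (f : M -> N) (lf : linear f) : {linear M -> N} :=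
  HB.pack f (GRing.isLinear.Build A M N *:%R f lf).

Lemma mod_isoI M N (f : M -> N) :
  linear f -> injective f -> (forall n, exists m, n = f m) -> mod_iso M N.
Proof. by move=> lf inj surj; exists (linear_of lf); apply: inj_surj_bij. Qed.

Section Image.
Variables (B M : lmodType A) (i : {linear B -> M}).

Definition lin_image : {pred M} := fun m => `[< exists b, m = i b >].

Lemma lin_image_submod : submod_closed lin_image.
Proof.
split=> [|a m n /asboolP[b ->] /asboolP[b' ->]]; apply/asboolP.
  by exists 0; rewrite linear0.
by exists (a *: b + b'); rewrite linearP.
Qed.
HB.instance Definition _ :=
  GRing.isSubmodClosed.Build A M lin_image lin_image_submod.

(** The retraction identifies M with the product of B and M / i(B), and indecomposability kills the
    second factor. *)
Lemma retract_iso (p : {linear M -> B}) :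
  (forall b, p (i b) = b) -> ~ mod_zero B -> indecomposable M -> mod_iso M B.
Proof.
move=> pK nzB [_ indM].
pose N : lmodType A := quotmod lin_image.
have isoM : mod_iso M (B * N)%type.
  apply: (@mod_isoI _ _ (fun m => (p m, \pi_N m)%qT : (B * N)%type)).
  - move=> a m n; rewrite linearP /= quotmod_piD quotmod_piZ; reflexivity.
  - move=> m n [e1 /eqP]; rewrite quotmod_eq => /asboolP[b e2].
    have b0 : b = 0 by rewrite -(pK b) -e2 linearB e1 subrr.
    by apply/eqP; rewrite -subr_eq0 e2 b0 linear0.
  - move=> [b n]; have [v ->] := quotmod_piP n.
    exists (v - i (p v) + i b).
    rewrite linearD linearB !pK subrr add0r; congr (_, _).
    apply/eqP; rewrite quotmod_eq; apply/asboolP; exists (p v - b).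
    by rewrite linearB opprD addrA opprB addrCA subrr addr0.
have [zB|zN] := indM _ _ isoM; first by case: nzB.
apply: (@mod_isoI _ _ p); first exact: linearP.
- move=> m n e.
  have [b mn] : exists b, m - n = i b.
    apply/asboolP; rewrite -[asbool _]/(m - n \in lin_image) -quotmod_eq.
    by rewrite (zN (\pi m)%qT) (zN (\pi n)%qT).
  have b0 : b = 0 by rewrite -(pK b) -mn linearB e subrr.
  by apply/eqP; rewrite -subr_eq0 mn b0 linear0.
- by move=> b; exists (i b).
Qed.

End Image.

(** B is isomorphic to the ideal J of A. J is a bare predicate; being an image makes it an ideal. *)
Definition ideal_model (J : A -> Prop) B : Prop :=
  exists g : {linear B -> A^o}, injective g /\ forall a, J a <-> exists b, a = g b.

Lemma ideal_model_iso J B B' : ideal_model J B -> ideal_model J B' -> mod_iso B B'.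
Proof.
move=> [g [gI gJ]] [h [hI hJ]].
have ex b : exists b', g b = h b' by apply/hJ/gJ; exists b.
have [f fE] := choice ex; apply: (@mod_isoI _ _ f).
- by move=> a b c; apply: hI; rewrite -fE !linearP !fE.
- by move=> b c e; apply: gI; rewrite !fE e.
- move=> b'; have [b e] : exists b, (h b' : A) = g b by apply/gJ/hJ; exists b'.
  by exists b; apply: hI; rewrite -fE.
Qed.

(* The section B -> M is b |-> (g b / c) v. *)
Lemma ideal_model_split (J : A -> Prop) B M (f : {linear M -> A^o}) (v : M) (c u u' : A) :
    ideal_model J B -> (forall m, J (f m)) -> mod_regular M c ->
    (forall a, c * a = 0 -> a = 0) -> u * u' = 1 ->
    (forall a, J a -> exists m, a *: v = c *: m) ->
    (forall a, J a -> a * f v = u * c * a) ->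
  ~ mod_zero B -> indecomposable M -> mod_iso M B.
Proof.
move=> [g [gI gJ]] fJ cM cA uu' cv fv nzB indM.
have Jg b : J (g b) by apply/gJ; exists b.
have [i iE] := choice (fun b => cv _ (Jg b)).
have cI := mod_regular_inj cM.
have li : linear i.
  move=> a b b'; apply: cI; rewrite -iE linearP scalerDl scalerDr -scalerA.
  by rewrite iE iE scaler_swap.
have [p pE] := choice (fun m => (gJ _).1 (fJ m)).
(* [f] multiplies by [u] when composed with the section, so the factor [u'] makes it a
   retraction. *)
have lp : linear (fun m => u' *: p m).
  move=> a m n; rewrite scaler_swap -scalerDr; congr (_ *: _).
  by apply: gI; rewrite -pE !linearP !pE.
apply: (@retract_iso _ _ (linear_of li) (linear_of lp)) => // b /=.
have E : c * f (i b) = g b * f v :> A.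
  by have := congr1 f (iE b); rewrite !linearZ => ->.
apply: gI; rewrite linearZ /= -pE.
apply/eqP; rewrite -subr_eq0; apply/eqP/cA.
rewrite mulrBr; apply/eqP; rewrite subr_eq0; apply/eqP.
rewrite -[u' *: _]/(u' * f (i b)) mulrCA E (fv _ (Jg b)).
by rewrite !mulrA [u' * u]mulrC uu' mul1r.
Qed.

End Splitting.

(** * Modules as matrices, and retractions onto ideals *)

Section MatrixModel.
Variable k : fieldType.
Local Notation R := (fps (fps k)).
Local Notation W := (RW k).
Local Notation Z := (RZ k).
Variable A : comNzRingType.

Definition branch_ideal (n1 : {rmorphism A -> R}) (a : A) : Prop := n1 a = 0.

(** Since x generates the kernel of [n2], this is the ideal (x, z^n); with the projections exchanged
    it is (y, z^n). *)
Definition glued_ideal (n2 : {rmorphism A -> R}) n (a : A) : Prop :=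
  exists t, n2 a = Z ^+ n * t.

(* A acts on R^r through a = n2 a + q x, where n1 a - n2 a = w q and x acts
   by X. *)
Definition mx_model (n1 n2 : {rmorphism A -> R}) (M : lmodType A) r
    (X : 'M[R]_r) (co : M -> 'cV[R]_r) : Prop :=
  [/\ bijective co, {morph co : m m' / m + m'}, X *m X = W *: X
    & forall a q m, n1 a - n2 a = W * q ->
        co (a *: m) = n2 a *: co m + q *: (X *m co m)].

(** Exchanging the branches replaces x by y = w - x. *)
Lemma mx_model_sym n1 n2 (M : lmodType A) r (X : 'M[R]_r) (co : M -> 'cV[R]_r) :
  mx_model n1 n2 X co -> mx_model n2 n1 (W%:M - X) co.
Proof.
case=> [bij add XX act]; split=> //.
  by rewrite mulmxBl mul_scalar_mx mulmxBr XX mul_mx_scalar subrr subr0.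
move=> a q m e; rewrite (act a (- q)); last by rewrite mulrN -e opprB.
rewrite mulmxBl mul_scalar_mx scalerBr scalerA scaleNr addrA; congr (_ - _).
by rewrite mulrC -e -scalerDl addrC subrK.
Qed.

Variables n1 n2 : {rmorphism A -> R}.
Hypothesis fpA : fibre_product n1 n2.
Local Notation lift := (fp_lift n1 n2).
Local Notation diag := (diag n1 n2).

Lemma mx_model_exists (M : lmodType A) r (e : 'I_r -> M) :
  bijective (comb n1 n2 e) -> exists X co, mx_model n1 n2 (M := M) (r := r) X co.
Proof.
case=> co combK coK; have cI : injective (comb n1 n2 e) := can_inj combK.
pose x := lift W 0; pose X := \matrix_(i, j) co (x *: e j) i 0.
have add : {morph co : m m' / m + m'}.
  by move=> m m'; apply: cI; rewrite (combD fpA) !coK.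
have co0 : co 0 = 0 by apply: (@addrI _ (co 0)); rewrite -add !addr0.
have coZ p m : co (diag p *: m) = p *: co m.
  by apply: cI; rewrite (combZ fpA) !coK.
have cox m : co (x *: m) = X *m co m.
  rewrite -{1}(coK m) /comb scaler_sumr (big_morph co add co0).
  apply/matrixP => i j; rewrite ord1 summxE !mxE; apply: eq_bigr => l _.
  by rewrite scaler_swap coZ !mxE mulrC.
exists X, co; split=> //; first by exists (comb n1 n2 e).
  apply: mulmx_inj => c; rewrite -(combK c) -mulmxA -!cox -scalemxAl -cox -coZ !scalerA.
  by congr (co (_ *: _)); apply: (fp_eq fpA); rewrite !rmorphM ?(diag1 fpA) ?(diag2 fpA)
    ?(lift_x1 fpA) ?(lift_x2 fpA) ?mulr0.
move=> a q m /(fp_decompE fpA) aE.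
by rewrite {1}aE scalerDl add coZ -scalerA cox coZ scalemxAr.
Qed.

Section Functional.
Variables (M : lmodType A) (r : nat) (X : 'M[R]_r) (co : M -> 'cV[R]_r).
Hypothesis modM : mx_model n1 n2 X co.
Implicit Types la : 'rV[R]_r.

Lemma mx_model_diag p m : co (diag p *: m) = p *: co m.
Proof.
case: modM => _ _ _ /(_ _ 0 m) ->; last by rewrite (diag1 fpA) (diag2 fpA) subrr mulr0.
by rewrite (diag2 fpA) scale0r addr0.
Qed.

Lemma mx_model_inj : injective co. Proof. by case: modM => /bij_inj. Qed.
Lemma mx_model_surj c : exists m, co m = c.
Proof. by case: modM => -[g _ gK] _ _ _; exists (g c). Qed.

Lemma mx_model_regular p : p != 0 -> mod_regular M (diag p).
Proof.
move=> p0 m e; apply: mx_model_inj; apply/matrixP => i j.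
have co0 : co 0 = 0 by rewrite -(scale0r 0) -(diag_0 fpA) mx_model_diag scale0r.
have /matrixP/(_ i j) := congr1 co e; rewrite mx_model_diag co0 !mxE => /eqP.
by rewrite mulf_eq0 (negPf p0) => /eqP.
Qed.

(* The A-linear map m |-> x la(m) - la(y m) attached to an R-linear form la. *)
Definition functional la (m : M) : A^o :=
  lift ((la *m X *m co m) 0 0) ((la *m (X - W%:M) *m co m) 0 0).

Lemma functional_coef0 la (c : 'cV[R]_r) :
  fps_coef0 ((la *m X *m c) 0 0) = fps_coef0 ((la *m (X - W%:M) *m c) 0 0).
Proof.
rewrite mulmxBr mulmxBl mul_mx_scalar -scalemxAl.
move: (la *m X *m c) (la *m c) => P Q.
by rewrite !mxE [RHS]rmorphB /= fps_coef0M mul0r subr0.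
Qed.

Lemma functional1 la m : n1 (functional la m) = (la *m X *m co m) 0 0.
Proof. exact/(fp_lift1 fpA)/functional_coef0. Qed.
Lemma functional2 la m : n2 (functional la m) = (la *m (X - W%:M) *m co m) 0 0.
Proof. exact/(fp_lift2 fpA)/functional_coef0. Qed.

Lemma functional_linear la : linear (functional la).
Proof.
have [_ add XX act] := modM.
move=> a m n; have [q qE] := fp_decomp fpA a.
have -> : functional la (a *: m + n) = a * functional la m + functional la n :> A; last by [].
apply: (fp_eq fpA); rewrite rmorphD rmorphM ?functional1 ?functional2 add (act a q) //.
  have XXc : la *m X *m (X *m co m) = W *: (la *m X *m co m).
    by rewrite mulmxA -[la *m X *m X]mulmxA XX -scalemxAr -scalemxAl.
  rewrite !mulmxDr -!scalemxAr XXc; move: (la *m X *m co m) (la *m X *m co n) => P Q.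
  by rewrite !mxE mulrA [q * W]mulrC -qE -mulrDl addrCA subrr addr0.
have XXc : la *m (X - W%:M) *m (X *m co m) = 0.
  by rewrite mulmxA -[la *m (_ - _) *m X]mulmxA mulmxBl XX mul_scalar_mx subrr mulmx0 mul0mx.
move: (la *m (X - W%:M)) XXc => L XXc.
rewrite !mulmxDr -!scalemxAr XXc scaler0 addr0.
move: (L *m co m) (L *m co n) => P Q.
by rewrite !mxE.
Qed.

Lemma mx_model_lreg p : p != 0 -> forall a, diag p * a = 0 -> a = 0.
Proof.
move=> p0 a e; apply: (fp_eq fpA); rewrite rmorph0.
  have /eqP := congr1 n1 e; rewrite rmorphM (diag1 fpA) rmorph0 mulf_eq0 (negPf p0).
  by move/eqP.
have /eqP := congr1 n2 e; rewrite rmorphM (diag2 fpA) rmorph0 mulf_eq0 (negPf p0).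
by move/eqP.
Qed.

Lemma row_mul_col m n l (B : 'M[R]_(m, n)) (C : 'M[R]_(n, l)) i j :
  (row i B *m col j C) 0 0 = (B *m C) i j.
Proof. by rewrite !mxE; apply: eq_bigr => t _; rewrite !mxE. Qed.

Lemma mul_col m n l (B : 'M[R]_(m, n)) (C : 'M[R]_(n, l)) j :
  B *m col j C = col j (B *m C).
Proof. by apply/matrixP => i t; rewrite !mxE; apply: eq_bigr => s _; rewrite mxE. Qed.

(** Row i of P gives a functional with values in (x), as P(X - w) = 0. Column j of P gives a vector
    on which elements of (x) act by multiples of w, and the functional takes the value (w P_ij, 0)
    there; so the splitting applies with c = w. *)
Lemma split_branch (B : lmodType A) (P : 'M[R]_r) i j :
    ideal_model (branch_ideal n2) B -> ~ mod_zero B -> indecomposable M ->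
    X = W *: P -> P *m P = P -> residue (P i j) != 0 ->
  mod_iso M B.
Proof.
move=> mB nzB indM XE PP Pij; have [_ _ _ act] := modM.
have [v vE] := mx_model_surj (col j P).
have W0 : W != 0 by apply: fpsX_neq0.
have PX : P *m X = W *: P by rewrite XE -scalemxAr PP.
have [u' uu'] : exists u', diag (P i j) * u' = 1.
  by apply: (fp_inverse fpA); rewrite (diag1 fpA).
apply: (@ideal_model_split _ _ _ _ (linear_of (functional_linear (row i P))) v
  (diag W) (diag (P i j)) u' mB) => //=.
- move=> m; rewrite /branch_ideal functional2 -row_mul mulmxBr PX mul_mx_scalar subrr.
  by rewrite row0 mul0mx mxE.
- exact: mx_model_regular.
- exact: mx_model_lreg.
- move=> a a2; have [q qE] := fp_decomp fpA a.
  have [m mE] := mx_model_surj (q *: col j P); exists m; apply: mx_model_inj.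
  rewrite mx_model_diag mE (act a q) // a2 scale0r add0r vE XE -scalemxAl mul_col PP.
  by rewrite scalerA [RHS]scalerA mulrC.
- move=> a a2; apply: (fp_eq fpA); rewrite !rmorphM ?(diag1 fpA) ?(diag2 fpA)
    ?a2 ?mul0r ?mulr0 //.
  rewrite functional1 vE -row_mul row_mul_col PX -scalemxAl PP mxE.
  by rewrite mulrC; congr (_ * _); rewrite mulrC.
Qed.

(** Both components of the functional at [v] are divisible by z^n. The quotients p and q still agree
    modulo w, so they glue to a unit of A, and the splitting applies with c = z^n. *)
Lemma split_glued_vector (B : lmodType A) n (la d : 'rV[R]_r) (c : 'cV[R]_r) v p :
    ideal_model (glued_ideal n2 n) B -> ~ mod_zero B ->
    indecomposable M -> la *m (X - W%:M) = Z ^+ n *: d ->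
    X *m co v = Z ^+ n *: c -> (la *m c) 0 0 = p -> residue p != 0 ->
  mod_iso M B.
Proof.
move=> mB nzB indM dE cE pE p0; have [_ _ _ act] := modM.
have Zn0 : Z ^+ n != 0 := RZ_neq0 k n.
pose F := functional la.
have F1 : n1 (F v) = Z ^+ n * p.
  by rewrite functional1 -mulmxA cE -scalemxAr -pE; move: (la *m c) => C; rewrite mxE.
have [q F2] : exists q, n2 (F v) = Z ^+ n * q.
  exists ((d *m co v) 0 0).
  by rewrite functional2 dE -scalemxAl; move: (d *m co v) => C; rewrite mxE.
have pq : fps_coef0 p = fps_coef0 q.
  by have := fp_coef0 fpA (F v); rewrite F1 F2 => /fps_coef0_Zn_inj.
have [u' uu'] : exists u', lift p q * u' = 1.
  by apply: (fp_inverse fpA); rewrite (fp_lift1 fpA).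
have FE : F v = lift p q * diag (Z ^+ n).
  apply: (fp_eq fpA); rewrite rmorphM.
    by rewrite F1 (fp_lift1 fpA) // (diag1 fpA) mulrC.
  by rewrite F2 (fp_lift2 fpA) // (diag2 fpA) mulrC.
apply: (@ideal_model_split _ _ _ _ (linear_of (functional_linear la)) v
  (diag (Z ^+ n)) (lift p q) u' mB) => //=.
- move=> m; exists ((d *m co m) 0 0).
  by rewrite functional2 dE -scalemxAl; move: (d *m co m) => C; rewrite mxE.
- exact: mx_model_regular.
- exact: mx_model_lreg.
- move=> a [t a2]; have [s sE] := fp_decomp fpA a.
  have [m mE] := mx_model_surj (t *: co v + s *: c); exists m; apply: mx_model_inj.
  by rewrite mx_model_diag mE (act a s) // a2 scalerDr scalerA cE !scalerA [s * _]mulrC.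
- by move=> a _; rewrite -[functional _ _]/(F v) FE mulrC.
Qed.

(** Because P - P^2 = z^n V, both P(X - w) = z^n (PY - wV) and X(1 - P) = z^n (Y(1 - P) + wV) are
    divisible by z^n; this dictates the choice of a row of P and a column of 1 - P. *)
Lemma split_glued (B : lmodType A) n (Y P V : 'M[R]_r) i j :
    ideal_model (glued_ideal n2 n) B -> ~ mod_zero B ->
    indecomposable M -> X = Z ^+ n *: Y + W *: P -> P - P *m P = Z ^+ n *: V ->
    residue ((P *m Y *m (1%:M - P)) i j) != 0 ->
  mod_iso M B.
Proof.
move=> mB nzB indM XE PP Yij.
have [v vE] := mx_model_surj (col j (1%:M - P)).
pose C := Y *m (1%:M - P) + W *: V; pose D := P *m Y - W *: V.
apply: (@split_glued_vector B n (row i P) (row i D) (col j C) v _ mB nzB indM).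
- rewrite -row_mul -linearZ; congr (row i _).
  rewrite [RHS]scalerBr [_ *: (W *: V)]scaler_swap -PP XE mulmxBr mulmxDr.
  by rewrite -!scalemxAr mul_mx_scalar scalerBr opprB addrA addrAC.
- rewrite vE mul_col -linearZ; congr (col j _).
  rewrite [RHS]scalerDr [_ *: (W *: V)]scaler_swap -PP XE mulmxDl -!scalemxAl.
  by congr (_ + _ *: _); rewrite mulmxBr mulmx1.
- exact: row_mul_col.
- rewrite mulmxDr mulmxA -scalemxAr; move: (P *m V) (P *m Y *m (1%:M - P)) Yij => C' D' Yij.
  by rewrite mxE [X in _ + X]mxE residueD residueM mul0r addr0.
Qed.

Lemma split_free (B : lmodType A) i j :
    ideal_model (fun=> True) B -> ~ mod_zero B -> indecomposable M ->
    residue (X i j) != 0 ->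
  mod_iso M B.
Proof.
move=> mB nzB indM Xij.
have [v vE] := mx_model_surj (col j 1%:M).
pose F := functional (row i 1%:M).
have [u' uu'] : exists u', F v * u' = 1.
  apply: (fp_inverse fpA).
  by rewrite functional1 vE -row_mul row_mul_col mul1mx mulmx1.
apply: (@ideal_model_split _ _ _ _ (linear_of (functional_linear (row i 1%:M))) v
  1 (F v) u' mB) => //=.
- by move=> m; rewrite scale1r.
- by move=> a; rewrite mul1r.
- by move=> a _; exists (a *: v); rewrite scale1r.
- by move=> a _; rewrite mulr1 mulrC.
Qed.

End Functional.
End MatrixModel.

(** * Classification *)

Lemma mx_order (K : fieldType) m n (B : 'M[fps K]_(m, n)) : B <> 0 ->
  exists t (C : 'M[fps K]_(m, n)), B = fpsX ^+ t *: C /\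
    exists i j, fps_coef0 (C i j) != 0.
Proof.
move=> nz; have ex : exists t, `[< exists i j, B i j t != 0 >].
  apply: contrapT => /forallNP h; apply: nz; apply/matrixP => i j; rewrite mxE.
  apply: fpsP => t; apply/eqP; apply: contrapT => /negP Bt.
  by apply: (h t); apply/asboolP; exists i, j.
case: (ex_minnP ex) => t /asboolP[i [j Bt]] min.
exists t, (\matrix_(i, j) Fps (fun s => B i j (s + t)%N)); split; last first.
  by exists i, j; rewrite mxE.
apply/matrixP => i' j'; rewrite !mxE; apply: fpsP => s; rewrite fpsXnM.
case: ltnP => [st|ts] /=; last by rewrite subnK.
apply/eqP; apply: contrapT => /negP Bs; move: st; rewrite ltnNge min //.
by apply/asboolP; exists i', j'.
Qed.

Section Classification.
Variable k : fieldType.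
Local Notation R := (fps (fps k)).
Local Notation W := (RW k).
Local Notation Z := (RZ k).

Definition residue_morph : {rmorphism R -> k} :=
  @fps_coef0 k \o @fps_coef0 (fps k).
Local Notation rho := (map_mx residue_morph).

Lemma mulmx_idem_compl (S : comNzRingType) r (P : 'M[S]_r) :
  P *m P = P -> (1%:M - P) *m (1%:M - P) = 1%:M - P.
Proof. by move=> PP; rewrite mulmxBl mul1mx mulmxBr mulmx1 PP subrr subr0. Qed.

Lemma nonzero_entry m n (B : 'M[k]_(m, n)) : B != 0 -> exists i j, B i j != 0.
Proof.
move=> nz; apply: contrapT => /forallNP h; case/eqP: nz; apply/matrixP => i j.
rewrite mxE; apply/eqP; apply: contrapT => /negP Bij.
by case: (h i); exists j.
Qed.

(** After division by w, the equation X^2 = wX equates z^n (YP + PY - Y) with w (P - P^2);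
    coprimality yields the common quotient V. *)
Lemma square_decomposition r n (X Y P : 'M[R]_r) :
    X = Z ^+ n *: Y + W *: P -> Y *m Y = 0 -> X *m X = W *: X ->
  exists V, P - P *m P = Z ^+ n *: V /\ Y *m P + P *m Y - Y = W *: V.
Proof.
move=> XE YY XX.
have E i j : exists t, (Y *m P + P *m Y - Y) i j = W * t /\ (P - P *m P) i j = Z ^+ n * t.
  apply: W_Z_cancel; apply: (@fpsX_inj (fps k)).
  have /matrixP/(_ i j) := XX; rewrite {}XE mulmxDl !mulmxDr -!scalemxAl -!scalemxAr YY.
  move: (P *m P) (Y *m P) (P *m Y) => PP YP PY; rewrite !mxE.
  move: (Y i j) (P i j) (PP i j) (YP i j) (PY i j) => y p pp yp py e.
  apply/eqP; rewrite -subr_eq0; apply/eqP.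
  change (W * (Z ^+ n * (yp + py - y)) - W * (W * (p - pp)) = 0).
  rewrite -(subrr (W * (Z ^+ n * y + W * p))) -{1}e; ring.
have [V VE] := choice (fun ij : 'I_r * 'I_r => E ij.1 ij.2).
exists (\matrix_(i, j) V (i, j)); split; apply/matrixP => i j; have /= [e1 e2] := VE (i, j).
  by rewrite e2 !mxE.
by rewrite e1 !mxE.
Qed.

Lemma residue_mxE r (B : 'M[R]_r) i j : rho B i j = residue (B i j).
Proof. by rewrite mxE. Qed.

Variable A : comNzRingType.

Lemma free1_model : ideal_model (fun=> True) ('cV[A]_1 : lmodType A).
Proof.
have l : linear (fun v : 'cV[A]_1 => v 0 0 : A^o) by move=> a u v; rewrite !mxE.
exists (linear_of l); split=> [u v /= e|a].
  by apply/matrixP => i j; rewrite !ord1.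
by split=> // _; exists (const_mx a); rewrite /= mxE.
Qed.

Lemma classification (n1 n2 : {rmorphism A -> R}) (M : lmodType A)
    (B1 B2 : lmodType A) (C1 C2 : nat -> lmodType A) a b :
    fibre_product n1 n2 ->
    ideal_model (branch_ideal n1) B1 -> ~ mod_zero B1 ->
    ideal_model (branch_ideal n2) B2 -> ~ mod_zero B2 ->
    (forall n, ideal_model (glued_ideal n1 n) (C1 n) /\ ~ mod_zero (C1 n)) ->
    (forall n, ideal_model (glued_ideal n2 n) (C2 n) /\ ~ mod_zero (C2 n)) ->
    indecomposable M -> ~ mod_free M -> finitely_generated M ->
    nonunit a -> nonunit b -> regular_pair M a b ->
  [\/ mod_iso M B1, mod_iso M B2
    | exists2 n, (1 <= n)%N & mod_iso M (C1 n) \/ mod_iso M (C2 n)].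
Proof.
move=> fpA mB1 nB1 mB2 nB2 mC1 mC2 indM nfM fgM nua nub rab.
have [r [e bij]] := regular_pair_basis fpA fgM nua nub rab.
have [X [co mm]] := mx_model_exists fpA bij; have mm' := mx_model_sym mm.
have fpA' := fibre_product_sym fpA.
have [_ _ XX _] := mm.
have [X0|X0] := pselect (map_mx (@fps_coef0 (fps k)) X = 0).
  have [P XE] : exists P, X = W *: P.
    have E i j : exists t, X i j = W * t.
      by apply: fps_coef0_eq0; have /matrixP/(_ i j) := X0; rewrite !mxE.
    have [P PE] := choice (fun ij : 'I_r * 'I_r => E ij.1 ij.2).
    by exists (\matrix_(i, j) P (i, j)); apply/matrixP => i j; rewrite (PE (i, j)) !mxE.
  have PP : P *m P = P.
    move: XX; rewrite XE -scalemxAl -scalemxAr; move: (P *m P) => Q /matrixP QE.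
    apply/matrixP => i j; do 2!apply: (@fpsX_inj (fps k)).
    by have := QE i j; rewrite !mxE.
  (* Either P has a unit entry, or 1 - P reduces to the identity and splits off the other branch;
     its size is positive because M is nonzero. *)
  have [P0|/nonzero_entry[i [j Pij]]] := eqVneq (rho P) 0; last first.
    apply: Or32; apply: (split_branch fpA mm mB2 nB2 indM XE PP (i := i) (j := j)).
    by rewrite -residue_mxE.
  case: r => [|r] in e bij X co mm mm' XX P X0 XE PP P0 *.
    case: indM => -[] m; apply: (mx_model_inj mm).
    by apply/matrixP => -[].
  apply: Or31; apply: (split_branch fpA' mm' mB1 nB1 indM (P := 1%:M - P) (i := 0) (j := 0)).
  - by rewrite XE scalerBr scalemx1.
  - exact: mulmx_idem_compl.
  - by rewrite -residue_mxE map_mxB P0 map_mx1 subr0 mxE eqxx oner_eq0.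
have [n [Y0 [X0E [i0 [j0 Y0ij]]]]] := mx_order X0.
pose Y := map_mx (@fpsC (fps k)) Y0.
have [P XE] : exists P, X = Z ^+ n *: Y + W *: P.
  have E i j : exists t, X i j = Z ^+ n * Y i j + W * t.
    have [t tE] := fps_split (X i j); exists t; rewrite tE; congr (_ + _).
    have /matrixP/(_ i j) := X0E; rewrite !mxE => ->.
    by rewrite rmorphM rmorphXn.
  have [P PE] := choice (fun ij : 'I_r * 'I_r => E ij.1 ij.2).
  by exists (\matrix_(i, j) P (i, j)); apply/matrixP => i j; rewrite (PE (i, j)) !mxE.
(* Y does not involve w, so the vanishing of X^2 modulo w becomes an exact equality for Y. *)
have YY : Y *m Y = 0.
  have := congr1 (map_mx (@fps_coef0 (fps k))) XX.
  have -> : map_mx (@fps_coef0 (fps k)) (W *: X) = 0.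
    by apply/matrixP => i j; rewrite !mxE fps_coef0M mul0r.
  rewrite map_mxM X0E -scalemxAl -scalemxAr => /matrixP YY.
  rewrite -map_mxM; suff -> : Y0 *m Y0 = 0 by rewrite map_mx0.
  apply/matrixP => i j; do 2!apply: (@fpsXn_inj k n).
  have := YY i j; move: (Y0 *m Y0) => YY0.
  by rewrite !mxE !mulr0.
have [V [PV YV]] := square_decomposition XE YY XX.
have rY : rho Y != 0.
  by apply/eqP => /matrixP/(_ i0 j0)/eqP; rewrite residue_mxE !mxE; apply/negP.
(* With exponent 0, X itself has a unit entry and M would be free of rank one. *)
case: n => [|n] in X0E XE PV *.
  case: nfM; exists 1%N.
  apply: (split_free fpA mm free1_model _ indM (i := i0) (j := j0)).
    move=> /(_ (const_mx 1))/matrixP/(_ 0 0)/eqP.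
    by rewrite !mxE oner_eq0.
  have -> : X i0 j0 = Y i0 j0 + W * P i0 j0 by rewrite XE expr0 scale1r !mxE.
  by rewrite residueD residueM mul0r addr0 mxE.
have rZ m (B : 'M[R]_m) c : residue c = 0 -> rho (c *: B) = 0.
  by move=> c0; apply/matrixP => i j; rewrite residue_mxE !mxE residueM c0 mul0r.
have rPP : rho P *m rho P = rho P.
  apply/eqP; rewrite eq_sym -subr_eq0 -map_mxM -map_mxB PV rZ //.
  by rewrite exprS residueM mul0r.
have rYP : rho Y = rho Y *m rho P + rho P *m rho Y.
  by apply/eqP; rewrite eq_sym -subr_eq0 -!map_mxM -map_mxD -map_mxB YV rZ.
(* Left multiplication of [rYP] by the idempotent gives PY = PYP + PY. *)
have rPYP : rho P *m rho Y *m rho P = 0.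
  have := congr1 (mulmx (rho P)) rYP; rewrite mulmxDr !mulmxA rPP => /eqP.
  by rewrite -subr_eq subrr eq_sym => /eqP.
apply: Or33; exists n.+1 => //.
have [PY0|/nonzero_entry[i [j PYij]]] := eqVneq (rho P *m rho Y) 0; last first.
  right; have [mC nC] := mC2 n.+1.
  apply: (split_glued fpA mm mC nC indM XE PV (i := i) (j := j)).
  rewrite -residue_mxE map_mxM map_mxB map_mx1 map_mxM mulmxBr mulmx1 rPYP subr0.
  exact: PYij.
(* Here Y = YP on residues. Exchanging the branches turns (Y, P) into (-Y, 1 - P) with the same V,
   and the required entry is one of -YP. *)
have [i [j Yij]] := nonzero_entry rY.
left; have [mC nC] := mC1 n.+1.
apply: (split_glued fpA' mm' mC nC indM (Y := - Y) (P := 1%:M - P) (V := V) (i := i) (j := j)).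
- by rewrite XE scalerBr scalemx1 scalerN opprD addrCA.
- by rewrite mulmxBl mul1mx mulmxBr mulmx1 -PV opprB addrC subrK.
rewrite subKr -residue_mxE !map_mxM map_mxB map_mx1 map_mxN.
rewrite mulmxBl mul1mx mulmxN PY0 oppr0 subr0 mulNmx mxE oppr_eq0.
by move: Yij; rewrite {1}rYP PY0 addr0.
Qed.

End Classification.

(** * Krull dimension *)

Section PrimeIdeals.
Variables (A : comNzRingType) (p : {pred A}).
Hypothesis pP : prime_ideal p.

Lemma prime_ideal0 : 0 \in p. Proof. by case: pP => -[]. Qed.
Lemma prime_ideal1 : 1 \notin p. Proof. by case: pP => -[]. Qed.
Lemma prime_idealD a b : a \in p -> b \in p -> a + b \in p.
Proof. by case: pP => -[_ _ h] _ pa pb; rewrite -[a]mul1r h. Qed.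
Lemma prime_idealMl a b : b \in p -> a * b \in p.
Proof. by case: pP => -[p0 _ h] _ pb; rewrite -[a * b]addr0 h. Qed.
Lemma prime_idealMr a b : a \in p -> a * b \in p.
Proof. by rewrite mulrC; apply: prime_idealMl. Qed.
Lemma prime_idealN a : a \in p -> - a \in p.
Proof. by rewrite -mulN1r; apply: prime_idealMl. Qed.
Lemma prime_idealP a b : a * b \in p -> a \in p \/ b \in p.
Proof. by case: pP => _ h /h/orP. Qed.
Lemma prime_idealX a n : a ^+ n \in p -> a \in p.
Proof.
elim: n => [|n IH]; first by rewrite expr0 => p1; have := prime_ideal1; rewrite p1.
by rewrite exprS => /prime_idealP[].
Qed.
Lemma prime_ideal_inv a b : a * b = 1 -> a \notin p.
Proof.
by move=> ab; apply: contraTN isT => pa; have := prime_ideal1; rewrite -ab prime_idealMr.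
Qed.
End PrimeIdeals.

Lemma prime_ideal_ker (A : comNzRingType) (D : idomainType) (u : {rmorphism A -> D}) :
  prime_ideal [pred a | u a == 0].
Proof.
split; last by move=> a b; rewrite !inE rmorphM mulf_eq0.
split=> [||c a b]; rewrite !inE ?rmorph0 ?rmorph1 ?oner_eq0 //.
by move=> /eqP a0 /eqP b0; rewrite rmorphD rmorphM a0 b0 mulr0 addr0.
Qed.

Lemma prime_ideal_preim (A B : comNzRingType) (u : A -> B) (p : {pred B}) :
    u 0 = 0 -> u 1 = 1 -> {morph u : a b / a + b} -> {morph u : a b / a * b} ->
  prime_ideal p -> prime_ideal [pred a | u a \in p].
Proof.
move=> u0 u1 uD uM pP; split; last first.
  by move=> a b; rewrite !inE uM => /(prime_idealP pP)/orP.
split=> [||c a b]; rewrite !inE ?u0 ?u1 ?prime_ideal0 ?prime_ideal1 // => pa pb.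
by rewrite uD uM prime_idealD ?prime_idealMl.
Qed.

(** * Dimension of k[[z]][[w]] by Weierstrass division *)

Section Weierstrass.
Variable k : fieldType.
Local Notation O := (fps k).
Local Notation R := (fps O).
Local Notation W := (RW k).
Local Notation Z := (RZ k).

(* The embedding of k[[W]] into k[[z]][[W]]. *)
Definition fps_outer : {rmorphism O -> R} := fps_map (@fpsC k).

Lemma fps_outerX : fps_outer fpsX = W.
Proof. by apply: fpsP => i /=; rewrite rmorph_nat. Qed.

Lemma coef_outer_mul (c : O) l i j : (fps_outer c * Z ^+ l) i j = if j == l then c i else 0.
Proof.
have -> : Z ^+ l = fpsC (fpsX ^+ l) by rewrite rmorphXn.
rewrite mulrC fpsCM fpsXnM /=; case: (ltngtP j l) => [||->] //=.
  by rewrite -subn_gt0; case: (_ - _)%N.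
by rewrite subnn.
Qed.

(** Long division along powers of w. Modulo w, [f] is z^d times a unit, so each coefficient in
    k[[z]] is divided by cutting it at degree d; the remainders are then polynomials of degree below
    d in z. *)
Lemma weierstrass_division (f h : R) d (u : O) :
    fps_coef0 f = fpsX ^+ d * u -> u \is a GRing.unit ->
  exists q (c : 'I_d -> O), h = q * f + \sum_(l < d) fps_outer (c l) * Z ^+ l.
Proof.
move=> f0 uu.
pose div (a : O) := (u^-1 * Fps (fun i => a (i + d)%N),
  Fps (fun i => if (i < d)%N then a i else 0)).
have [a|q [r [hE rE]]] := @fps_division O f div _ h.
  rewrite f0 mulrC -mulrA mulVKr //; apply: fpsP => i.
  rewrite fpsD fpsXnM /=; case: ltnP => id; first by rewrite add0r.
  by rewrite addr0 subnK.
exists q, (fun l => Fps (fun i => r i l)); rewrite {1}hE; congr (_ + _).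
apply: fpsP => i; apply: fpsP => j; rewrite !fps_sum.
under eq_bigr => l _ do rewrite coef_outer_mul /=.
case: (ltnP j d) => jd; last first.
  rewrite rE /= ltnNge jd big1 // => l _; case: eqP => // jl.
  by have := ltn_ord l; rewrite -jl ltnNge jd.
rewrite (bigD1 (Ordinal jd)) //= eqxx big1 ?addr0 // => l.
by rewrite -val_eqE /= eq_sym => /negPf ->.
Qed.

(* Cayley-Hamilton for multiplication by h on R / (f), which is generated by
   1, ..., z^(d-1) over k[[W]]. *)
Lemma weierstrass_integral (f h : R) d (u : O) :
    fps_coef0 f = fpsX ^+ d.+1 * u -> u \is a GRing.unit ->
  exists chi : {poly O}, chi != 0 /\ exists g, (map_poly fps_outer chi).[h] = f * g.
Proof.
move=> f0 uu.
have [q qE] := choice (fun l : 'I_d.+1 => weierstrass_division (h * Z ^+ l) f0 uu).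
have [c cE] := choice qE.
pose C := \matrix_(i, j) c i j.
exists (char_poly C); split; first exact/monic_neq0/char_poly_monic.
pose ev : {rmorphism {poly O} -> R} := horner_eval h \o map_poly fps_outer.
pose N := h%:M - map_mx fps_outer C.
have -> : (map_poly fps_outer (char_poly C)).[h] = \det N.
  rewrite -[LHS]/(ev _) /char_poly -det_map_mx; congr (\det _).
  apply/matrixP => i j; rewrite !mxE rmorphB rmorphMn /= /horner_eval.
  by rewrite map_polyX map_polyC hornerX hornerC.
pose v : 'cV[R]_d.+1 := \col_l Z ^+ l.
have Nv : N *m v = f *: \col_l q l.
  rewrite mulmxBl mul_scalar_mx; apply/matrixP => i j; rewrite !mxE cE.
  rewrite [X in _ - X](_ : _ = \sum_(l < d.+1) fps_outer (c i l) * Z ^+ l).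
    by rewrite addrK mulrC.
  by apply: eq_bigr => l _; rewrite !mxE.
exists ((\adj N *m \col_l q l) 0 0).
have /matrixP/(_ 0 0) : \det N *: v = f *: (\adj N *m \col_l q l).
  by rewrite scalemxAr -Nv mulmxA mul_adj_mx mul_scalar_mx.
move: (\adj N *m _) => Q.
by rewrite !mxE expr0 mulr1.
Qed.

(** A prime strictly above a nonzero prime is maximal. Unless w lies in p, removing powers of w from
    f leaves an element f' of p that is nonzero modulo w, and R / (f') is integral over k[[w]]. *)
Lemma prime_gap (p q : {pred R}) (f h : R) :
    prime_ideal p -> prime_ideal q -> {subset p <= q} ->
    f \in p -> f != 0 -> h \in q -> h \notin p ->
  W \in q /\ Z \in q.
Proof.
move=> pP qP pq fp fn0 hq hp.
(* A nonzero series in one variable is a power of the variable times a unit, so a prime containing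
   it contains the variable. *)
have pow (a : O) (v : {rmorphism O -> R}) : a != 0 -> v a \in q -> v fpsX \in q.
  move=> /fps_field_order[m [u [-> uu]]]; rewrite rmorphM rmorphXn.
  move=> /(prime_idealP qP)[/(prime_idealX qP)//|].
  have /(prime_ideal_inv qP)/negPf -> // : v u * v u^-1 = 1.
  by rewrite -rmorphM divrr // rmorph1.
have [Wp|Wp] := boolP (W \in p).
  split; first exact: pq.
  have [g hE] := fps_split h.
  apply: (pow (fps_coef0 h) (@fpsC O)).
    apply: contraNneq hp => h0; rewrite hE h0 rmorph0 add0r.
    exact: prime_idealMr.
  rewrite [X in X \in q](_ : _ = h + - (W * g)); last by rewrite {2}hE addrK.
  apply: (prime_idealD qP) => //.
  exact/(prime_idealN qP)/(prime_idealMr qP)/pq.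
have [m [f' [fE f'0]]] := fps_order fn0.
have f'p : f' \in p.
  move: fp; rewrite fE => /(prime_idealP pP)[/(prime_idealX pP)|//].
  by rewrite -[fpsX]/W (negPf Wp).
have [d [u [f0 uu]]] := fps_field_order f'0.
have Wq : W \in q.
  case: d f0 => [|d] f0.
    have uf' : f' \is a GRing.unit by apply: fps_unit_coef0; rewrite f0 mul1r.
    by have := prime_ideal_inv pP (divrr uf'); rewrite f'p.
  (* The constant term of a relation of least degree for h modulo p is nonzero
     and lies in q. *)
  have ex : exists n, `[< exists chi : {poly O}, [/\ size chi = n, chi != 0 &
      (map_poly fps_outer chi).[h] \in p] >].
    have [chi [chi0 [g e]]] := weierstrass_integral h f0 uu.
    by exists (size chi); apply/asboolP; exists chi; split=> //; rewrite e (prime_idealMr pP).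
  case: (ex_minnP ex) => n /asboolP[chi [sz chi0 chih]] min.
  have chiE : chi = (chi`_0)%:P + drop_poly 1 chi * 'X.
    rewrite -{1}(poly_take_drop 1 chi) expr1; congr (_ + _).
    by apply/polyP => -[|i]; rewrite coef_take_poly coefC.
  have hE : (map_poly fps_outer chi).[h] =
      fps_outer chi`_0 + (map_poly fps_outer (drop_poly 1 chi)).[h] * h.
    by rewrite {1}chiE rmorphD rmorphM /= map_polyC map_polyX hornerD hornerM hornerX hornerC.
  rewrite -fps_outerX; apply: (pow chi`_0); last first.
    have -> : fps_outer chi`_0 =
        (map_poly fps_outer chi).[h] + - ((map_poly fps_outer (drop_poly 1 chi)).[h] * h).
      by rewrite hE addrK.
    apply: (prime_idealD qP); first exact: pq.
    exact/(prime_idealN qP)/(prime_idealMl qP).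
  apply/eqP => c0; move: chih; rewrite hE c0 rmorph0 add0r.
  move=> /(prime_idealP pP)[dp|]; last by rewrite (negPf hp).
  have : (n <= size (drop_poly 1 chi))%N.
    apply: min; apply/asboolP; exists (drop_poly 1 chi); split=> //.
    by apply: contraNneq chi0 => d0; rewrite chiE c0 d0 mul0r addr0.
  rewrite size_drop_poly sz leqNgt subn1; case: n sz {ex min} => [/eqP|n _ /negP[] //].
  by rewrite size_poly_eq0 (negPf chi0).
(* Modulo w, which is now in q, f' is a nonzero series in z. *)
split=> //.
have [g f'E] := fps_split f'.
apply: (pow (fps_coef0 f') (@fpsC O)) => //.
rewrite [X in X \in q](_ : _ = f' + - (W * g)); last by rewrite {2}f'E addrK.
apply: (prime_idealD qP); first exact: pq.
exact/(prime_idealN qP)/(prime_idealMr qP).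
Qed.

Section Dimension.
Variables (A : comNzRingType).

(** Pull the chain back to R along [diag]. Since A = [diag] R + xA and x lies in every member,
    strict inclusions stay strict; four primes of R would put the third equal to (w, z) and leave no
    room for the fourth. *)
Lemma prime_chain_bound (n1 n2 : {rmorphism A -> R}) e (p : nat -> {pred A}) :
    fibre_product n1 n2 -> prime_chain e p -> fp_lift n1 n2 W 0 \in p 0%N ->
  (e <= 2)%N.
Proof.
move=> fpA [pP pS] xp; rewrite leqNgt; apply/negP => lt2e.
have {}pP i : (i <= 3)%N -> prime_ideal (p i) by move=> le; apply/pP/(leq_trans le).
have {}pS i : (i < 3)%N -> {subset p i <= p i.+1} /\ ~ {subset p i.+1 <= p i}.
  by move=> lt; apply/pS/(leq_trans lt).
set x := fp_lift n1 n2 W 0 in xp.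
have xpi i : (i <= 3)%N -> x \in p i.
  by elim: i => // i IH lt; apply: (pS i lt).1; apply/IH/ltnW.
pose P i : {pred R} := [pred r | diag n1 n2 r \in p i].
have PP i : (i <= 3)%N -> prime_ideal (P i).
  move=> le; apply: prime_ideal_preim (pP i le).
  - exact: diag_0.
  - exact: diag_1.
  - exact: diagD.
  - exact: diagM.
have step i : (i < 3)%N -> exists2 r, r \in P i.+1 & r \notin P i.
  move=> lt; have [_ /existsNP[a /not_implyP[ap /negP nap]]] := pS i lt.
  have [t /(fp_decompE fpA) aE] := fp_decomp fpA a.
  exists (n2 a); rewrite inE.
    have -> : diag n1 n2 (n2 a) = a + - (x * diag n1 n2 t) by rewrite {2}aE addrK.
    apply: (prime_idealD (pP _ lt)) => //.
    by apply/(prime_idealN (pP _ lt))/(prime_idealMr (pP _ lt))/xpi.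
  apply: contra nap => dp; rewrite aE.
  apply: (prime_idealD (pP _ (ltnW lt))) => //.
  by apply/(prime_idealMr (pP _ (ltnW lt)))/xpi/ltnW.
have [f f1 f0] := step 0%N isT; have [h h2 h1] := step 1%N isT.
have [g g3 g2] := step 2%N isT.
have sub12 : {subset P 1%N <= P 2%N} by move=> r; apply: (pS 1%N isT).1.
have fn0 : f != 0 by apply: contraNneq f0 => ->; apply: prime_ideal0 (PP 0%N isT).
have [W2 Z2] := prime_gap (PP 1%N isT) (PP 2%N isT) sub12 f1 fn0 h2 h1.
have [/residue_eq0[a [b gE]]|/residue_unit gu] := eqVneq (residue g) 0.
  have P2 := PP 2%N isT.
  by move: g2; rewrite gE (prime_idealD P2) ?(prime_idealMr P2).
by have := prime_ideal_inv (PP 3%N isT) (divrr gu); rewrite g3.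
Qed.

Lemma fibre_product_krull_dim (n1 n2 : {rmorphism A -> R}) :
  fibre_product n1 n2 -> has_krull_dim A 2.
Proof.
move=> fpA; have fpA' := fibre_product_sym fpA; split; last first.
  move=> e [p pc]; have [pP _] := pc.
  have : fp_lift n1 n2 W 0 * fp_lift n1 n2 0 W \in p 0%N.
    rewrite (_ : _ * _ = 0); first exact: prime_ideal0 (pP 0%N _).
    apply: (fp_eq fpA); rewrite rmorphM rmorph0.
      by rewrite (fp_lift1 fpA) ?(fp_lift1 fpA) ?mulr0.
    by rewrite (fp_lift2 fpA) ?(fp_lift2 fpA) ?mul0r.
  move=> /(prime_idealP (pP 0%N isT))[]; first exact: prime_chain_bound pc.
  by rewrite (fp_lift_sym fpA) //; apply: prime_chain_bound fpA' pc.
pose u1 : {rmorphism A -> O} := @fps_coef0 O \o n2.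
pose u2 : {rmorphism A -> k} := @fps_coef0 k \o u1.
(* The chain (x), (x, y), (x, y, z). *)
exists (fun i => match i return {pred A} with
  | 0 => [pred a | n2 a == 0] | 1 => [pred a | u1 a == 0] | _ => [pred a | u2 a == 0] end).
split=> [[|[|[|//]]] _|[|[|//]] _]; [exact: prime_ideal_ker n2|
  exact: prime_ideal_ker u1|exact: prime_ideal_ker u2| |].
  split=> [a|sub]; first by rewrite !inE /= => /eqP ->; rewrite rmorph0.
  have : diag n1 n2 W \in [pred a | n2 a == 0].
    by apply: sub; rewrite inE -[u1 _]/(fps_coef0 (n2 _)) (diag2 fpA).
  by rewrite inE (diag2 fpA); apply/negP/fpsX_neq0.
split=> [a|sub]; first by rewrite !inE /= => /eqP ->; rewrite rmorph0.
have : diag n1 n2 Z \in [pred a | u1 a == 0].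
  by apply: sub; rewrite inE -[u2 _]/(residue (n2 _)) (diag2 fpA).
by rewrite inE -[u1 _]/(fps_coef0 (n2 _)) (diag2 fpA); apply/negP/fpsX_neq0.
Qed.

End Dimension.
End Weierstrass.

(** * Normalization *)

Section Fractions.
Variable D : idomainType.
Local Notation tofrac := (@FracField.tofrac D).

Lemma tofrac_repr (q : {fraction D}) : exists p s, s != 0 /\ q * tofrac s = tofrac p.
Proof.
elim/quotW: q => x; exists (frac x).1, (frac x).2; split; first exact: denom_ratioP.
rewrite /FracField.tofrac; unlock; rewrite -[LHS]FracField.pi_mul /FracField.mulf.
apply/eqmodP; rewrite /= FracField.equivfE !numden_Ratio ?oner_neq0 ?mulf_neq0
  ?denom_ratioP //;
  by rewrite ?oner_neq0 // !mulr1 mulrC.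
Qed.

Lemma tofrac_inj : injective tofrac.
Proof. by move=> a b /eqP; rewrite tofrac_eq => /eqP. Qed.

(** If q = p / s is a root of a monic polynomial of degree m, then s^m clears q^n for n <= m, and
    the equation reduces higher powers to lower ones. *)
Lemma integral_common_denominator (P : {poly D}) (q : {fraction D}) p s :
    P \is monic -> root (map_poly tofrac P) q -> q * tofrac s = tofrac p ->
  forall n, exists g, tofrac (s ^+ (size P).-1) * q ^+ n = tofrac g.
Proof.
move=> monP rP qs; set m := (size P).-1.
have szP : size P = m.+1 by rewrite prednK // lt0n size_poly_eq0 monic_neq0.
have qm : q ^+ m = - \sum_(i < m) tofrac P`_i * q ^+ i.
  apply/eqP; rewrite -addr_eq0 addrC; move: rP; rewrite rootE horner_coef.
  rewrite size_map_inj_poly ?tofrac0 //; last exact: tofrac_inj.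
  rewrite szP big_ord_recr /= coef_map /=.
  move/monicP: monP; rewrite lead_coefE -/m => ->; rewrite tofrac1 mul1r.
  by under eq_bigr => i _ do rewrite coef_map /=.
elim/ltn_ind => n IH; have [lenm|ltmn] := leqP n m.
  exists (s ^+ (m - n) * p ^+ n).
  by rewrite -{1}(subnK lenm) exprD !tofracM !tofracXn -qs exprMn -mulrA [_ * q ^+ n]mulrC.
have [|g gE] := @choice 'I_m D (fun i g => tofrac (s ^+ m) * q ^+ (n - m + i) = tofrac g).
  by move=> i; apply: IH; rewrite -ltn_subRL subKn ?ltn_ord // ltnW.
exists (- \sum_(i < m) P`_i * g i).
rewrite -{1}(subnK (ltnW ltmn)) exprD qm mulrA mulrN tofracN rmorph_sum mulr_sumr.
congr (- _); apply: eq_bigr => i _; rewrite rmorphM /= -gE exprD.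
by rewrite mulrCA !mulrA.
Qed.

Lemma cic_integrally_closed (P : {poly D}) (q : {fraction D}) :
    completely_integrally_closed D -> P \is monic -> root (map_poly tofrac P) q ->
  exists r, q = tofrac r.
Proof.
move=> cicD monP rP; have [p [s [s0 qs]]] := tofrac_repr q.
have [||n|t tE] := @cicD p s (s ^+ (size P).-1) => //; first by rewrite expf_neq0.
  have [g gE] := integral_common_denominator monP rP qs n; exists g; apply: tofrac_inj.
  by rewrite !tofracM !tofracXn -qs exprMn mulrA -tofracXn gE mulrC.
exists t; apply: (@mulIf _ (tofrac s)); first by rewrite tofrac_eq0.
by rewrite qs tE tofracM mulrC.
Qed.
End Fractions.

Lemma root_map_XsubC2 (A B : comNzRingType) (i : {rmorphism A -> B}) a b q :
  (q - i a) * (q - i b) = 0 -> root (map_poly i (('X - a%:P) * ('X - b%:P))) q.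
Proof. by move=> e; rewrite rmorphM /= !map_polyXsubC rootE hornerM !hornerXsubC e. Qed.

Section PairFractions.
Variable D : idomainType.

Definition pair_tofrac (r : (D * D)%type) : ({fraction D} * {fraction D})%type :=
  (FracField.tofrac r.1, FracField.tofrac r.2).

Lemma pair_tofrac_zmod : zmod_morphism pair_tofrac.
Proof. by move=> r s; rewrite /pair_tofrac !tofracB. Qed.
Lemma pair_tofrac_monoid : monoid_morphism pair_tofrac.
Proof. by split=> [|r s]; rewrite /pair_tofrac ?tofrac1 ?tofracM. Qed.
HB.instance Definition _ :=
  GRing.isZmodMorphism.Build _ _ pair_tofrac pair_tofrac_zmod.
HB.instance Definition _ :=
  GRing.isMonoidMorphism.Build _ _ pair_tofrac pair_tofrac_monoid.
End PairFractions.

Section Normalization.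
Variable k : fieldType.
Local Notation R := (fps (fps k)).
Local Notation W := (RW k).
Local Notation K := {fraction R}.
Variables (A : comNzRingType) (nu : {rmorphism A -> (R * R)%type}).
Local Notation n1 := (fst \o nu : {rmorphism A -> R}).
Local Notation n2 := (snd \o nu : {rmorphism A -> R}).
Hypothesis fpA : fibre_product n1 n2.

Lemma fibre_product_lreg s : GRing.lreg s -> n1 s != 0 /\ n2 s != 0.
Proof.
move=> reg; split; apply/eqP => s0.
  have /reg : s * fp_lift n1 n2 W 0 = s * 0.
    apply: (fp_eq fpA); rewrite mulr0 rmorphM rmorph0 ?s0 ?mul0r //.
    by rewrite (fp_lift2 fpA) ?mulr0.
  move/(congr1 n1); rewrite (fp_lift1 fpA) // rmorph0.
  by apply/eqP/fpsX_neq0.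
have /reg : s * fp_lift n1 n2 0 W = s * 0.
  apply: (fp_eq fpA); rewrite mulr0 rmorphM rmorph0 ?s0 ?mul0r //.
  by rewrite (fp_lift1 fpA) ?mulr0.
move/(congr1 n2); rewrite (fp_lift2 fpA) // rmorph0.
by apply/eqP/fpsX_neq0.
Qed.

Lemma lreg_fibre_product s : n1 s != 0 -> n2 s != 0 -> GRing.lreg s.
Proof.
move=> s1 s2 a b e; apply: (fp_eq fpA).
  by apply: (mulfI s1); rewrite -!rmorphM e.
by apply: (mulfI s2); rewrite -!rmorphM e.
Qed.

Lemma fibre_product_normalization :
  completely_integrally_closed R -> is_normalization nu.
Proof.
move=> cicR; exists (K * K)%type, (@pair_tofrac R).
pose i : {rmorphism A -> (K * K)%type} := @pair_tofrac R \o nu.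
have iE a : i a = (FracField.tofrac (n1 a), FracField.tofrac (n2 a)) by [].
split.
- split.
  + move=> a b e; have := e : i a = i b; rewrite !iE => -[/tofrac_inj e1 /tofrac_inj e2].
    exact: (fp_eq fpA).
  + move=> s /fibre_product_lreg[s1 s2].
    exists ((FracField.tofrac (n1 s))^-1, (FracField.tofrac (n2 s))^-1).
    rewrite -[LHS]/(i s * _) iE.
    by congr (_, _); rewrite /= mulfV // tofrac_eq0.
  + move=> [q1 q2].
    have [p1 [s1 [s10 e1]]] := tofrac_repr q1; have [p2 [s2 [s20 e2]]] := tofrac_repr q2.
    (* Multiplying all numerators and denominators by w makes them vanish modulo w, so they glue to
       elements of A. *)
    have c0 a b : fps_coef0 (W * a) = fps_coef0 (W * b) by rewrite !fps_coef0M !mul0r.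
    exists (fp_lift n1 n2 (W * p1) (W * p2)), (fp_lift n1 n2 (W * s1) (W * s2)); split.
      apply: lreg_fibre_product; rewrite ?(fp_lift1 fpA) ?(fp_lift2 fpA) //;
      by rewrite mulf_neq0 // fpsX_neq0.
    rewrite -[RHS]/(i _) -[LHS]/((q1, q2) * i _) !iE !(fp_lift1 fpA) ?(fp_lift2 fpA) //.
    rewrite !tofracM -e1 -e2.
    by congr (_, _); rewrite /= mulrCA.
- by move=> [r1 r2] [s1 s2] [/tofrac_inj -> /tofrac_inj ->].
move=> q; split=> [[P monP rP]|[[r1 r2] ->]].
  have [r1 e1] : exists r, q.1 = FracField.tofrac r.
    apply: (@cic_integrally_closed _ (map_poly n1 P)) => //; first exact: monic_map.
    rewrite -map_poly_comp.
    by have := rmorph_root (fst : {rmorphism K * K -> K}) rP; rewrite -map_poly_comp.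
  have [r2 e2] : exists r, q.2 = FracField.tofrac r.
    apply: (@cic_integrally_closed _ (map_poly n2 P)) => //; first exact: monic_map.
    rewrite -map_poly_comp.
    by have := rmorph_root (snd : {rmorphism K * K -> K}) rP; rewrite -map_poly_comp.
  by exists (r1, r2); rewrite [LHS]surjective_pairing e1 e2.
(* Each factor vanishes at (r1, r2) on one of the two branches. *)
exists (('X - (diag n1 n2 r1)%:P) * ('X - (diag n1 n2 r2)%:P)).
  by rewrite monicMl ?monicXsubC.
apply: (root_map_XsubC2 (i := i)); rewrite !iE.
rewrite !(diag1 fpA) !(diag2 fpA); congr (_, _) => /=.
  by rewrite subrr mul0r.
by rewrite subrr mulr0.
Qed.
End Normalization.

(** * The ring k[[x,y,z]]/(xy) as a fibre product *)

Section ConcreteRing.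
Variable k : fieldType.
Local Notation R := (fps (fps k)).

Lemma nu1_toA f : nu1 k (toA k f) = S_to_R1 k f.
Proof. by rewrite /nu1 /= /nu_fun; have := congr1 fst (nu_toA f). Qed.
Lemma nu2_toA f : nu2 k (toA k f) = S_to_R2 k f.
Proof. by rewrite /nu2 /= /nu_fun; have := congr1 snd (nu_toA f). Qed.

Lemma Aring_fibre_product :
  fibre_product (nu1 k : {rmorphism Aring k -> R}) (nu2 k : {rmorphism Aring k -> R}).
Proof.
split.
- by move=> a; have [f ->] := toA_surj a; rewrite nu1_toA nu2_toA.
- move=> r1 r2 e.
  (* The part free of x is [r2], and the positive powers of x come from [r1]; the coefficient of x^0
     in [r1] is recovered from [r2] by the gluing condition. *)
  exists (toA k (Fps (fun a => if a == 0%N then r2 else fpsC (r1 a)) : Sring k)).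
  rewrite nu1_toA nu2_toA; split=> //.
  by apply: fpsP => -[|a] //=.
move=> a b; have [f ->] := toA_surj a; have [g ->] := toA_surj b.
rewrite !nu1_toA !nu2_toA => e1 e2.
suff: f - g \in @xy_ideal k by rewrite Quotient.idealrBE => /eqP.
apply/asboolP.
have [|h hE] := @fps_coef0_eq0 _ (f - g).
  rewrite rmorphB; apply/eqP; rewrite subr_eq0; apply/eqP; exact: e2.
(* [h] is (f - g) / x, and its coefficients are divisible by y because f and g agree at y = 0. *)
have h0 a' : exists t, h a' = fpsX * t.
  have e : fps_coef0 (f a'.+1) = fps_coef0 (g a'.+1) := congr1 (fun r : R => r a'.+1) e1.
  have ha : h a' = (f - g) a'.+1 by rewrite hE fpsXM.
  apply: fps_coef0_eq0; rewrite ha -[LHS]/(fps_coef0 (f a'.+1) - fps_coef0 (g a'.+1)).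
  by rewrite e subrr.
have [t tE] := choice h0.
exists (Fps t); rewrite hE [RHS]mulrC -[RHS]mulrA; congr (_ * _); apply: fpsP => a'.
by rewrite fpsCM tE.
Qed.
End ConcreteRing.

(** * Ideals as cokernels *)

Section CokernelModel.
Variables (A : comNzRingType) (m n : nat) (B : 'M[A]_(m, n)).

Lemma coker_finitely_generated : finitely_generated (coker B).
Proof.
exists m, (fun i => (\pi_(quotmod (colspan B)) (delta_mx i 0))%qT) => q.
have [v ->] := quotmod_piP q; exists (fun i => v i 0).
rewrite {1}[v]matrix_sum_delta.
have -> : \sum_i \sum_j v i j *: delta_mx i j = \sum_i v i 0 *: delta_mx i 0 :> 'cV[A]_m.
  by apply: eq_bigr => i _; rewrite big_ord1.
elim/big_rec2: _ => [|i q' v' _ IH].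
  by apply: (@addrI _ (\pi_(quotmod (colspan B)) 0)%qT); rewrite -quotmod_piD !addr0.
by rewrite quotmod_piD quotmod_piZ IH.
Qed.

(** The first isomorphism theorem; the induced map is evaluated on representatives. *)
Lemma coker_model (J : A -> Prop) (g : 'cV[A]_m -> A^o) :
    linear g -> (forall w, g (B *m w) = 0) ->
    (forall v, g v = 0 -> exists w, v = B *m w) ->
    (forall a, J a <-> exists v, a = g v) ->
  ideal_model J (coker B).
Proof.
move=> lg gB kerg gJ; pose G := linear_of lg.
have Gpi v : G (repr (\pi_(quotmod (colspan B)) v)%qT) = G v.
  apply/eqP; rewrite -subr_eq0 -linearB.
  have : repr (\pi_(quotmod (colspan B)) v)%qT - v \in colspan B.
    by rewrite -quotmod_eq reprK.
  by move=> /asboolP[w ->]; apply/eqP/gB.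
have lG : linear (fun q : coker B => G (repr q)).
  move=> a p q; have [u ->] := quotmod_piP p; have [v ->] := quotmod_piP q.
  rewrite -[a *: _](quotmod_piZ (colspan B)) -quotmod_piD !Gpi; exact: linearP.
exists (linear_of lG); split=> [p q /= e|a].
  rewrite -[p]reprK -[q]reprK; apply/eqP; rewrite quotmod_eq; apply/asboolP.
  apply: kerg; rewrite -[g _]/(G _) linearB; apply/eqP; rewrite subr_eq0; exact/eqP.
rewrite gJ; split=> [[v ->]|[q ->]] /=; last by exists (repr q).
by exists (\pi_(quotmod (colspan B)) v)%qT; rewrite -[RHS]/(G (repr _)) Gpi.
Qed.

End CokernelModel.

Section Models.
Variable k : fieldType.
Local Notation R := (fps (fps k)).
Local Notation W := (RW k).
Local Notation Z := (RZ k).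
Variable A : comNzRingType.

Variables n1 n2 : {rmorphism A -> R}.
Hypothesis fpA : fibre_product n1 n2.
Local Notation lift := (fp_lift n1 n2).
Local Notation diag := (diag n1 n2).
Let fpA' := fibre_product_sym fpA.

Lemma branch_idealP x a : n1 x = W -> n2 x = 0 -> n2 a = 0 -> exists t, a = x * diag t.
Proof.
move=> x1 x2 a2; have [t e] := fp_decomp fpA a; exists t.
apply: (fp_eq fpA); rewrite rmorphM ?x2 ?mul0r ?a2 // x1 (diag1 fpA) -e a2 subr0 //.
Qed.

Lemma branch_idealP' y a : n1 y = 0 -> n2 y = W -> n1 a = 0 -> exists t, a = y * diag t.
Proof.
move=> y1 y2 a1; have [t e] := fp_decomp fpA' a; exists t.
apply: (fp_eq fpA); rewrite rmorphM ?y1 ?mul0r ?a1 // y2 (diag2 fpA) -e a1 subr0 //.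
Qed.

(** Multiplication by y maps A onto (y) with kernel (x). *)
Lemma scalar_coker_branch_model (B : 'M[A]_1) x y :
    n1 x = W -> n2 x = 0 -> n1 y = 0 -> n2 y = W -> B 0 0 = x ->
  ideal_model (branch_ideal n1) (coker B).
Proof.
move=> x1 x2 y1 y2 B00.
have BE (w : 'cV[A]_1) : (B *m w) 0 0 = x * w 0 0 by rewrite mxE big_ord1 B00.
apply: (@coker_model _ _ _ _ _ (fun v => y * v 0 0)).
- by move=> a u v; rewrite !mxE mulrDr mulrCA.
- move=> w; rewrite BE mulrA; apply: (fp_eq fpA).
    by rewrite !rmorphM y1 !mul0r rmorph0.
  by rewrite !rmorphM x2 mulr0 mul0r rmorph0.
- move=> v v0; have [|t tE] := @branch_idealP x (v 0 0) x1 x2.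
    have /eqP := congr1 n2 v0; rewrite rmorphM rmorph0 y2 mulf_eq0 (negPf (fpsX_neq0 _)).
    by move/eqP.
  by exists (const_mx (diag t)); apply/matrixP => i j; rewrite !ord1 BE mxE.
- move=> a; split=> [a1|[v ->]]; last by rewrite /branch_ideal rmorphM y1 mul0r.
  have [t ->] := branch_idealP' y1 y2 a1.
  by exists (const_mx (diag t)); rewrite mxE.
Qed.

(** The map sending v to x v_0 - c v_1 has image (x, z^n) and kernel the columns (y, 0) and (c, x).
    The factor [e], with e^2 = 1, absorbs the sign that distinguishes [psi] from [phi]. *)
Lemma triangular_coker_glued_model (B : 'M[A]_2) n x y c (e : R) :
    n1 x = W -> n2 x = 0 -> n1 y = 0 -> n2 y = W ->
    n1 c = Z ^+ n * e -> n2 c = Z ^+ n * e -> e * e = 1 ->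
    B 0 0 = y -> B 0 1 = c -> B 1 0 = 0 -> B 1 1 = x ->
  ideal_model (glued_ideal n2 n) (coker B).
Proof.
move=> x1 x2 y1 y2 c1 c2 ee B00 B01 B10 B11.
have ne0 : Z ^+ n * e != 0.
  by rewrite mulf_neq0 ?RZ_neq0 //; apply: contra_eq_neq ee => ->; rewrite mul0r eq_sym oner_neq0.
have BE0 (w : 'cV[A]_2) : (B *m w) 0 0 = y * w 0 0 + c * w 1 0.
  by rewrite mxE big_ord_recl big_ord1 B00 -B01; congr (_ + B _ _ * w _ _); apply: val_inj.
have BE1 (w : 'cV[A]_2) : (B *m w) 1 0 = x * w 1 0.
  rewrite mxE big_ord_recl big_ord1 B10 mul0r add0r -B11.
  by congr (B _ _ * w _ _); apply: val_inj.
have cV2 (v v' : 'cV[A]_2) : v 0 0 = v' 0 0 -> v 1 0 = v' 1 0 -> v = v'.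
  move=> e0 e1; apply/matrixP => i j; rewrite !ord1.
  have [->|->] // : i = 0 \/ i = 1.
  by case: i => -[|[|//]] lt; [left|right]; apply: val_inj.
pose vec (a b : A) : 'cV[A]_2 := \col_i (if i == 0 then a else b).
apply: (@coker_model _ _ _ _ _ (fun v => x * v 0 0 - c * v 1 0)).
- by move=> a u v; rewrite !mxE /GRing.scale /=; ring.
- move=> w; rewrite BE0 BE1.
  have xy : x * y = 0 by apply: (fp_eq fpA); rewrite rmorphM rmorph0 ?y1 ?x2 ?mulr0 ?mul0r.
  rewrite [LHS](_ : _ = x * y * w 0 0); last by ring.
  by rewrite xy mul0r.
(* On the second branch c v_1 = 0, so v_1 = x t; cancelling w on the first branch then puts v_0 - c
   t in (y). *)
- move=> v /eqP; rewrite subr_eq0 => /eqP v0.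
  have [|t tE] := @branch_idealP x (v 1 0) x1 x2.
    have /eqP := congr1 n2 v0; rewrite !rmorphM x2 mul0r c2 eq_sym mulf_eq0 (negPf ne0).
    by move/eqP.
  have [|s sE] := @branch_idealP' y (v 0 0 - c * diag t) y1 y2.
    rewrite rmorphB rmorphM (diag1 fpA); apply: (@fpsX_inj (fps k)).
    have := congr1 n1 v0; rewrite tE !rmorphM x1 (diag1 fpA) /= => e1.
    by rewrite mulrBr mulr0 [W * _]e1 mulrCA subrr.
  exists (vec (diag s) (diag t)); apply: cV2; rewrite ?BE0 ?BE1 !mxE /= //.
  by rewrite -sE subrK.
- move=> a; split=> [[t a2]|[v ->]]; last first.
    exists (- e * n2 (v 1 0)); rewrite rmorphB !rmorphM x2 mul0r c2 sub0r; ring.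
  pose b := - diag (e * t).
  have [|s sE] := @branch_idealP x (a + c * b) x1 x2.
    rewrite rmorphD rmorphM rmorphN (diag2 fpA) c2 a2.
    by rewrite mulrN mulrA -[_ * e * e]mulrA ee mulr1 subrr.
  exists (vec (diag s) b); rewrite !mxE /= -sE addrK //.
Qed.

(** The second branch embeds in A as the ideal (y), by r |-> (0, w r). *)
Lemma restrict_scalars_branch_model :
  ideal_model (branch_ideal n1) (restrict_scalars n2 : lmodType A).
Proof.
have e r : fps_coef0 0 = fps_coef0 (W * r) by rewrite fps_coef0M mul0r.
have l : linear (fun r : restrict_scalars n2 => lift 0 (W * (r : R)) : A^o).
  move=> a r s; apply: (fp_eq fpA).
    by rewrite rmorphD rmorphM !(fp_lift1 fpA) // mulr0 addr0.
  rewrite rmorphD rmorphM !(fp_lift2 fpA) // mulrDr; congr (_ + _).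
  by rewrite -[a *: r]/(n2 a * (r : R)) mulrCA.
exists (linear_of l); split=> [r s /= /(congr1 n2)|a].
  by rewrite !(fp_lift2 fpA) // => /fpsX_inj.
split=> [a1|[r ->]] /=; last by rewrite /branch_ideal (fp_lift1 fpA).
have [t tE] := fp_decomp fpA' a; exists (t : restrict_scalars n2); apply: (fp_eq fpA).
  by rewrite (fp_lift1 fpA).
by rewrite (fp_lift2 fpA) // -tE a1 subr0.
Qed.

(** * Depth, indecomposability and non-freeness of ideals *)

Section ModelProperties.
Variables (J : A -> Prop) (B : lmodType A).
Hypothesis modB : ideal_model J B.

Lemma model_nonzero a : J a -> a != 0 -> ~ mod_zero B.
Proof.
case: modB => g [_ gJ] /gJ[b ->] nz zB; case/eqP: nz.
by rewrite (zB b); apply: linear0.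
Qed.

(** The pair (w, z) is regular on A. The saturation hypothesis keeps the quotient by w inside J, so
    the pair stays regular on B; and B = (w, z)B would make every element of J vanish to all
    orders. *)
Lemma model_cohen_macaulay a0 :
    (forall a, J (diag W * a) -> J a) -> J a0 -> a0 != 0 -> finitely_generated B ->
    has_krull_dim A 2 ->
  cohen_macaulay B.
Proof.
move=> satJ Ja0 a0n fgB dimA; have := model_nonzero Ja0 a0n.
case: modB => g [gI gJ] nzB.
have gZ a b : g (a *: b) = a * g b :> A by rewrite linearZ.
apply: (cohen_macaulayI fpA) => //.
  split=> [|b b' e].
    move=> b e; apply: gI; rewrite linear0; apply: (mx_model_lreg fpA (fpsX_neq0 _)).
    by rewrite -gZ e linear0.
  have e1 := congr1 n1 (congr1 g e : g _ = g _ :> A).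
  have e2 := congr1 n2 (congr1 g e : g _ = g _ :> A).
  rewrite !gZ !rmorphM !(diag1 fpA) -(expr1 Z) in e1.
  rewrite !gZ !rmorphM !(diag2 fpA) -(expr1 Z) in e2.
  have [t1 [b1 b1']] := W_Z_cancel e1; have [t2 [b2 b2']] := W_Z_cancel e2.
  have t12 : fps_coef0 t1 = fps_coef0 t2.
    by apply: (@fps_coef0_Zn_inj k 1); rewrite -b1' -b2' (fp_coef0 fpA).
  have gbE : g b = diag W * lift t1 t2.
    apply: (fp_eq fpA); rewrite rmorphM.
      by rewrite (diag1 fpA) (fp_lift1 fpA).
    by rewrite (diag2 fpA) (fp_lift2 fpA).
  have /satJ/gJ[b'' b''E] : J (diag W * lift t1 t2) by rewrite -gbE; apply/gJ; exists b.
  by exists b''; apply: gI; rewrite [RHS]gZ -b''E.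
apply: contrapT => h; apply: nzB => b.
have {}h (m : B) : exists p q : B, m = diag W *: p + diag Z *: q.
  apply: contrapT => hm; apply: h; exists m => p q e.
  by apply: hm; exists p, q.
have van j : forall m, vanishes j (n1 (g m)) /\ vanishes j (n2 (g m)).
  elim: j => [|j IH] m; first by split.
  have [p [q ->]] := h m; rewrite linearD.
  have -> : g (diag W *: p) + g (diag Z *: q) = diag W * g p + diag Z * g q :> A by rewrite -!gZ.
  rewrite !rmorphD !rmorphM !(diag1 fpA) !(diag2 fpA).
  by have [? ?] := IH p; have [? ?] := IH q; split; apply: vanishesD;
    [apply: vanishesW|apply: vanishesZ|apply: vanishesW|apply: vanishesZ].
apply: gI; rewrite linear0; apply: (fp_eq fpA); rewrite rmorph0; apply: vanishes_eq0 => j.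
  by have [] := van j b.
by have [] := van j b.
Qed.

(** A decomposition of B writes J as a direct sum of two ideals, whose product lies in their
    intersection and is therefore zero. *)
Lemma model_summands (N1 N2 : lmodType A) : mod_iso B (N1 * N2)%type ->
  exists g1 : {linear N1 -> A^o}, exists g2 : {linear N2 -> A^o},
    [/\ injective g1, injective g2,
        (forall u, J (g1 u)) /\ (forall v, J (g2 v)),
        forall u v, g1 u * g2 v = 0 & forall a, J a -> exists u v, a = g1 u + g2 v].
Proof.
case: modB => g [gI gJ] [f [f' fK f'K]].
have lf' : linear f' by move=> a u v; apply: (can_inj fK); rewrite linearP !f'K.
pose F := linear_of lf'.
have l1 : linear (fun u : N1 => g (F (u, 0))).
  move=> a u v; rewrite -!linearP; congr (g (F _)).
  by congr (_, _); rewrite /= scaler0 addr0.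
have l2 : linear (fun u : N2 => g (F (0, u))).
  move=> a u v; rewrite -!linearP; congr (g (F _)).
  by congr (_, _); rewrite /= scaler0 addr0.
exists (linear_of l1), (linear_of l2).
have FI : injective F by apply: (can_inj f'K).
have i1 : injective (linear_of l1) by move=> u v /gI/FI[].
have i2 : injective (linear_of l2) by move=> u v /gI/FI[].
split=> //.
- by split=> u; apply/gJ; eexists.
- move=> u v; set a := linear_of l1 u; set b := linear_of l2 v.
  have e : linear_of l1 (b *: u) = linear_of l2 (a *: v).
    by rewrite !linearZ -[LHS]/(b * a) -[RHS]/(a * b) mulrC.
  move/gI/FI: e => [e1 e2].
  have -> : a * b = linear_of l1 (b *: u) by rewrite linearZ mulrC.
  by rewrite e1 linear0.
- move=> a /gJ[b ->]; case fb: (f b) => [u v]; exists u, v.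
  have -> : b = F (u, 0) + F (0, v).
    rewrite -linearD -[b]fK fb; congr (f' _).
    by congr (_, _); rewrite /= ?addr0 ?add0r.
  exact: linearD.
Qed.

End ModelProperties.

Lemma branch_indecomposable B :
  ideal_model (branch_ideal n1) B -> ~ mod_zero B -> indecomposable B.
Proof.
move=> mB nz; split=> // N1 N2 /(model_summands mB)[g1 [g2 [i1 i2 [J1 J2] g12 _]]].
have [z1|/existsNP[u u0]] := pselect (mod_zero N1); first by left.
right=> v; apply: i2; rewrite linear0.
have /eqP := congr1 n2 (g12 u v); rewrite rmorphM rmorph0 mulf_eq0 => /orP[]/eqP e.
  case: u0; apply: i1; rewrite linear0; apply: (fp_eq fpA); rewrite rmorph0 //.
  exact: J1.
apply: (fp_eq fpA); rewrite rmorph0 //; exact: J2.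
Qed.

(** Write z^n = a + b along the two summands, with ab = 0. If a and b vanished on opposite branches,
    gluing would make z^n zero modulo w. So one of them is 0, and then the nonzerodivisor z^n kills
    the summand containing it. *)
Lemma glued_indecomposable B n :
  ideal_model (glued_ideal n2 n) B -> ~ mod_zero B -> indecomposable B.
Proof.
move=> mB nz; split=> // N1 N2 /(model_summands mB)[g1 [g2 [i1 i2 _ g12 surj]]].
have [|u [v zE]] := surj (diag (Z ^+ n)).
  by exists 1; rewrite (diag2 fpA) mulr1.
have zreg a : diag (Z ^+ n) * a = 0 -> a = 0.
  exact: (mx_model_lreg fpA (RZ_neq0 k n)).
have bad : ~ (n1 (g1 u) = 0 /\ n2 (g2 v) = 0) /\ ~ (n2 (g1 u) = 0 /\ n1 (g2 v) = 0).
  have E1 : n1 (g1 u) + n1 (g2 v) = Z ^+ n by rewrite -rmorphD -zE (diag1 fpA).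
  split=> -[e1 e2]; have /eqP := coef0_RZ_neq0 k n; apply.
    by rewrite -E1 e1 add0r (fp_coef0 fpA) e2 rmorph0.
  by rewrite -E1 e2 addr0 (fp_coef0 fpA) e1 rmorph0.
have /eqP := congr1 n1 (g12 u v); rewrite rmorphM rmorph0 mulf_eq0.
have /eqP := congr1 n2 (g12 u v); rewrite rmorphM rmorph0 mulf_eq0.
move=> /orP[]/eqP e2 /orP[]/eqP e1.
- left=> u'; apply: i1; rewrite linear0; apply: zreg; rewrite zE.
  have -> : g1 u = 0 by apply: (fp_eq fpA); rewrite ?rmorph0.
  by rewrite add0r mulrC; apply: g12.
- by case: bad.2.
- by case: bad.1.
- right=> v'; apply: i2; rewrite linear0; apply: zreg; rewrite zE.
  have -> : g2 v = 0 by apply: (fp_eq fpA); rewrite ?rmorph0.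
  by rewrite addr0; apply: g12.
Qed.

(** The ideal (y) is killed by x, which kills no free module of positive rank. *)
Lemma branch_not_free B : ideal_model (branch_ideal n1) B -> ~ mod_zero B -> ~ mod_free B.
Proof.
move=> [g [gI gJ]] nz [[|s] [f [f' fK f'K]]].
  by apply: nz => b; apply: (can_inj fK); apply/matrixP => -[].
pose b := f' (const_mx 1); pose x := lift W 0.
have xb : x *: b = 0.
  apply: gI; rewrite linear0 linearZ -[LHS]/(x * g b).
  have gb : n1 (g b) = 0 by apply/gJ; exists b.
  apply: (fp_eq fpA); rewrite rmorphM rmorph0 ?gb ?mulr0 //.
  by rewrite (lift_x2 fpA) mul0r.
have /matrixP/(_ 0 0) := congr1 f xb.
rewrite linearZ linear0 f'K !mxE mulr1 => /(congr1 n1).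
by rewrite (lift_x1 fpA) rmorph0; apply/eqP/fpsX_neq0.
Qed.

Lemma glued_not_free B n : (0 < n)%N ->
  ideal_model (glued_ideal n2 n) B -> ~ mod_zero B -> ~ mod_free B.
Proof.
move=> n0 [g [gI gJ]] nz [s [f [f' fK f'K]]].
have lf' : linear f' by move=> a u v; apply: (can_inj fK); rewrite linearP !f'K.
case: s => [|[|s]] in f f' fK f'K lf' *.
- by apply: nz => b; apply: (can_inj fK); apply/matrixP => -[].
(* A generator u of (x, z^n) divides z^n, so it is nonzero modulo w; dividing x as well, it is a
   unit on the first branch. Yet its second component is a multiple of z^n, and n > 0. *)
- pose u : A := g (f' (const_mx 1)).
  have gen a : glued_ideal n2 n a -> exists c, a = c * u.
    move=> /gJ[b ->]; exists (f b 0 0).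
    have {1}-> : b = f b 0 0 *: f' (const_mx 1).
      apply: (can_inj fK); rewrite linearZ f'K; apply/matrixP => i j.
      by rewrite !ord1 !mxE mulr1.
    by rewrite linearZ.
  have [|al xE] := gen (lift W 0); first by exists 0; rewrite (lift_x2 fpA) mulr0.
  have [|be zE] := gen (diag (Z ^+ n)); first by exists 1; rewrite (diag2 fpA) mulr1.
  have x1 := congr1 n1 xE; rewrite (lift_x1 fpA) rmorphM in x1.
  have z1 := congr1 n1 zE; rewrite (diag1 fpA) rmorphM in z1.
  have u0 : fps_coef0 (n1 u) != 0.
    by apply: contraNneq (coef0_RZ_neq0 k n) => u0; rewrite z1 fps_coef0M u0 mulr0.
  have [|t tE] := @fps_coef0_eq0 _ (n1 al).
    have /eqP := congr1 (@fps_coef0 _) x1; rewrite fps_coef0M eq_sym.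
    by rewrite mulf_eq0 (negPf u0) orbF => /eqP.
  have tu : t * n1 u = 1.
    by apply: (@fpsX_inj (fps k)); rewrite /= mulrA -tE -x1 mulr1.
  have [s u2] : glued_ideal n2 n u by apply/gJ; eexists.
  have := congr1 (@residue k) tu; rewrite residueM [residue (n1 u)]/residue (fp_coef0 fpA).
  rewrite u2 -[fps_coef0 (fps_coef0 _)]/(residue _) residueM -(prednK n0) exprS residueM.
  by rewrite !mul0r mulr0 => /eqP; rewrite eq_sym oner_eq0.
(* For rank at least two: any two elements of an ideal satisfy g(b_1) b_0 = g(b_0) b_1, which
   contradicts independence. *)
pose b i := f' (delta_mx i 0).
have e : g (b 1) *: b 0 = g (b 0) *: b 1.
  by apply: gI; rewrite !linearZ -[LHS]/(_ * _) mulrC.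
have /matrixP/(_ 0 0) := congr1 f e.
rewrite !linearZ !f'K !mxE /= mulr1 mulr0 => b10.
have b1 : b 1 = 0 by apply: gI; rewrite linear0.
have /matrixP/(_ 1 0)/eqP := congr1 f b1.
by rewrite f'K linear0 !mxE /= oner_eq0.
Qed.

End Models.

(** * The listed modules *)

Section ListedModules.
Variable k : fieldType.
Local Notation R := (fps (fps k)).
Local Notation W := (RW k).
Local Notation Z := (RZ k).
Variable A : comNzRingType.
Variables n1 n2 : {rmorphism A -> R}.
Hypothesis fpA : fibre_product n1 n2.

Let dimA := fibre_product_krull_dim fpA.

Lemma branch_module (B : lmodType A) :
    ideal_model (branch_ideal n1) B -> finitely_generated B ->
  ~ mod_zero B /\ [/\ indecomposable B, ~ mod_free B & cohen_macaulay B].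
Proof.
move=> mB fgB; pose y := fp_lift n1 n2 0 W.
have Jy : branch_ideal n1 y by apply: (fp_lift1 fpA).
have y0 : y != 0.
  apply/eqP => /(congr1 n2); rewrite (fp_lift2 fpA) // rmorph0.
  by apply/eqP/fpsX_neq0.
have nz := model_nonzero mB Jy y0; split=> //; split.
- exact: (branch_indecomposable fpA mB nz).
- exact: (branch_not_free fpA mB nz).
apply: (model_cohen_macaulay fpA mB _ Jy y0 fgB dimA) => a.
rewrite /branch_ideal rmorphM (diag1 fpA) => /eqP.
by rewrite mulf_eq0 (negPf (fpsX_neq0 _)) => /eqP.
Qed.

Lemma glued_module_nonzero (B : lmodType A) n :
  ideal_model (glued_ideal n2 n) B -> ~ mod_zero B.
Proof.
move=> mB; apply: (model_nonzero mB (a := fp_lift n1 n2 W 0)).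
  by exists 0; rewrite mulr0 (fp_lift2 fpA).
apply/eqP => /(congr1 n1); rewrite (fp_lift1 fpA) // rmorph0.
by apply/eqP/fpsX_neq0.
Qed.

Lemma glued_module (B : lmodType A) n :
    (1 <= n)%N -> ideal_model (glued_ideal n2 n) B -> finitely_generated B ->
  [/\ indecomposable B, ~ mod_free B & cohen_macaulay B].
Proof.
move=> n0 mB fgB; pose x := fp_lift n1 n2 W 0.
have Jx : glued_ideal n2 n x by exists 0; rewrite mulr0 (fp_lift2 fpA).
have x0 : x != 0.
  apply/eqP => /(congr1 n1); rewrite (fp_lift1 fpA) // rmorph0.
  by apply/eqP/fpsX_neq0.
have nz := glued_module_nonzero mB; split.
- exact: (glued_indecomposable fpA mB nz).
- exact: (glued_not_free fpA n0 mB nz).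
apply: (model_cohen_macaulay fpA mB _ Jx x0 fgB dimA) => a [t].
rewrite rmorphM (diag2 fpA) => /esym/W_Z_cancel[s [_ e]].
by exists s.
Qed.

End ListedModules.

Section AringModels.
Variable k : fieldType.
Local Notation R := (fps (fps k)).
Local Notation A := (Aring k).
Local Notation n1 := (nu1 k : {rmorphism A -> R}).
Local Notation n2 := (nu2 k : {rmorphism A -> R}).

Let fpA : fibre_product n1 n2 := @Aring_fibre_product k.
Let fpA' : fibre_product n2 n1 := fibre_product_sym fpA.

Lemma nu1_x : n1 (toA k (Sx k)) = RW k.
Proof. exact: (congr1 fst (nu_x k)). Qed.
Lemma nu2_x : n2 (toA k (Sx k)) = 0.
Proof. exact: (congr1 snd (nu_x k)). Qed.
Lemma nu1_y : n1 (toA k (Sy k)) = 0.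
Proof. exact: (congr1 fst (nu_y k)). Qed.
Lemma nu2_y : n2 (toA k (Sy k)) = RW k.
Proof. exact: (congr1 snd (nu_y k)). Qed.
Lemma nu1_z : n1 (toA k (Sz k)) = RZ k.
Proof. exact: (congr1 fst (nu_z k)). Qed.
Lemma nu2_z : n2 (toA k (Sz k)) = RZ k.
Proof. exact: (congr1 snd (nu_z k)). Qed.

Lemma M_xy_model : ideal_model (branch_ideal n1) (mf_module (mf_xy k)).
Proof.
apply: (scalar_coker_branch_model fpA nu1_x nu2_x nu1_y nu2_y).
by rewrite !mxE.
Qed.

Lemma M_yx_model : ideal_model (branch_ideal n2) (mf_module (mf_swap (mf_xy k))).
Proof.
apply: (scalar_coker_branch_model fpA' nu2_y nu1_y nu2_x nu1_x).
by rewrite !mxE.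
Qed.

Lemma M_phi_psi_model n : ideal_model (glued_ideal n2 n) (mf_module (mf_phi_psi k n)).
Proof.
apply: (triangular_coker_glued_model fpA (c := toA k (Sz k ^+ n)) (e := 1)
  nu1_x nu2_x nu1_y nu2_y).
- by rewrite rmorphXn rmorphXn nu1_z mulr1.
- by rewrite rmorphXn rmorphXn nu2_z mulr1.
- exact: mulr1.
- by rewrite !mxE.
- by rewrite !mxE.
- by rewrite !mxE /= rmorph0.
- by rewrite !mxE.
Qed.

Lemma M_psi_phi_model n :
  ideal_model (glued_ideal n1 n) (mf_module (mf_swap (mf_phi_psi k n))).
Proof.
apply: (triangular_coker_glued_model fpA' (c := toA k (- Sz k ^+ n)) (e := - 1)
  nu2_y nu1_y nu2_x nu1_x).
- by rewrite rmorphN rmorphXn rmorphN rmorphXn nu2_z mulrN1.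
- by rewrite rmorphN rmorphXn rmorphN rmorphXn nu1_z mulrN1.
- by rewrite mulrNN mulr1.
- by rewrite !mxE.
- by rewrite !mxE.
- by rewrite !mxE /= rmorph0.
- by rewrite !mxE.
Qed.

End AringModels.

Theorem theorem5p3 (k : closedFieldType) :
  let ind_nonfree_CM (M : lmodType (Aring k)) :=
    [/\ indecomposable M, ~ mod_free M & cohen_macaulay M] in
  let M_x_y := mf_module (mf_xy k) in
  let M_y_x := mf_module (mf_swap (mf_xy k)) in
  let M_phi_psi (n : nat) := mf_module (mf_phi_psi k n) in
  let M_psi_phi (n : nat) := mf_module (mf_swap (mf_phi_psi k n)) in
  [/\ [/\ is_normalization (nu k),
          mod_iso M_x_y (R2mod k)
        & mod_iso M_y_x (R1mod k)],
      ind_nonfree_CM M_x_y /\ ind_nonfree_CM M_y_x,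
      forall n : nat, (1 <= n)%N ->
        ind_nonfree_CM (M_phi_psi n) /\ ind_nonfree_CM (M_psi_phi n)
    & forall M : lmodType (Aring k), ind_nonfree_CM M ->
        [\/ mod_iso M M_x_y,
            mod_iso M M_y_x
          | exists2 n : nat, (1 <= n)%N &
              mod_iso M (M_phi_psi n) \/ mod_iso M (M_psi_phi n)]].
Proof.
move=> ind M_x_y M_y_x M_phi_psi M_psi_phi.
have fpA := Aring_fibre_product k; have fpA' := fibre_product_sym fpA.
have [nzxy indxy] := branch_module fpA (M_xy_model k) (coker_finitely_generated _).
have [nzyx indyx] := branch_module fpA' (M_yx_model k) (coker_finitely_generated _).
split.
- split.
  + apply: (fibre_product_normalization fpA).
    do 2!apply: fps_completely_integrally_closed.
    exact: field_completely_integrally_closed.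
  + exact: (ideal_model_iso (M_xy_model k) (restrict_scalars_branch_model fpA)).
  + exact: (ideal_model_iso (M_yx_model k) (restrict_scalars_branch_model fpA')).
- exact: (conj indxy indyx).
- move=> n n0; split.
    exact: (glued_module fpA n0 (M_phi_psi_model k n) (coker_finitely_generated _)).
  exact: (glued_module fpA' n0 (M_psi_phi_model k n) (coker_finitely_generated _)).
move=> M [indM nfM [fgM [d [dimd ledim] [[s [nus regs] sizes] _]]]].
have [dim2 le2] := fibre_product_krull_dim fpA.
(* The Krull dimension is determined by its two bounds, so the depth condition supplies a regular
   sequence of length exactly two. *)
have {ledim le2} d2 : d = 2%N by apply/eqP; rewrite eqn_leq le2 ?ledim.
case: s => [|a [|b [|? ?]]] in nus regs sizes *; rewrite {}d2 // in sizes.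
have nua : nonunit a by apply: nus; rewrite mem_head.
have nub : nonunit b by apply: nus; rewrite inE mem_head orbT.
have [?|?|[n n0 [?|?]]] := classification fpA (M_xy_model k) nzxy (M_yx_model k) nzyx
  (fun n => conj (M_psi_phi_model k n) (glued_module_nonzero fpA' (M_psi_phi_model k n)))
  (fun n => conj (M_phi_psi_model k n) (glued_module_nonzero fpA (M_phi_psi_model k n)))
  indM nfM fgM nua nub (regular_sequence_pair regs).
- by apply: Or31.
- by apply: Or32.
- by apply: Or33; exists n => //; right.
- by apply: Or33; exists n => //; left.
Qed.
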